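(* Let $\Theta\subset\mathbb{R}^p$ be a nonempty connected open set, $\alpha>0$, $\beta>0$. For each $\theta\in\Theta$ let $g_\theta:\mathbb{R}^n\to\mathbb{R}\cup\{+\infty\}$ and $f^*_\theta:\mathbb{R}^m\to\mathbb{R}\cup\{+\infty\}$ be closed, proper, $\alpha$-strongly convex, and $K_\theta\in\mathbb{R}^{m\times n}$ with $0<\|K_\theta\|_{\mathrm{op}}\le\beta$. Let $\gamma\in\big(0,\frac{2\alpha}{(\alpha+\beta)^2}\big)$ and assume that $T(\theta,u,v):=\big(\mathrm{prox}_{\gamma g_\theta}(u),\mathrm{prox}_{\gamma f^*_\theta}(v)\big)$ and $\mathcal{B}(\theta,x,y):=(K_\theta^*y,\,-K_\theta x)$ are path differentiable jointly in $(\theta,x,y)\in\Theta\times\mathbb{R}^n\times\mathbb{R}^m$. Then for each $\theta$ the problem $\min_{x}\max_{y}\ g_\theta(x)+\langle K_\theta x,y\rangle-f_\theta^*(y)$ has a unique saddle point $z^\star(\theta)=(x^\star(\theta),y^\star(\theta))$, characterized by $K_\theta x^\star\in\partial f^*_\theta(y^\star)$ and $-K_\theta^* y^\star\in\partial g_\theta(x^\star)$, and $\theta\mapsto z^\star(\theta)$ is path differentiable on $\Theta$ with conservative Jacobian $$\mathcal{J}_{z^\star}(\theta)=\Big\{\big(\mathrm{Id}_{n+m}-V(\mathrm{Id}_{n+m}-\gamma Z)\big)^{-1}\big(U-\gamma VW\big):[U\ V]\in\mathrm{Jac}^c_T\big(\theta,\,x^\star(\theta)-\gamma K_\theta^*y^\star(\theta),\,y^\star(\theta)+\gamma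 K_\theta x^\star(\theta)\big),\ [W\ Z]\in\mathrm{Jac}^c_{\mathcal{B}}(\theta,x^\star(\theta),y^\star(\theta))\Big\}.$$
   Context: $\mathrm{prox}_g(x)=\mathrm{argmin}_u\, g(u)+\frac12\|x-u\|^2$; $\partial$ is the convex subdifferential. Clarke Jacobian: for a locally Lipschitz $F:\mathbb{R}^N\to\mathbb{R}^k$, $\mathrm{Jac}^c_F(z)=\mathrm{conv}\{\lim_j \mathrm{Jac}_F(z_j): z_j\to z,\ F \text{ differentiable at } z_j\}$. A conservative Jacobian for a locally Lipschitz $F$ is a set-valued map $\mathcal{J}_F$ with nonempty values, locally bounded, with closed graph, such that for every absolutely continuous curve $c:[0,1]\to\mathbb{R}^N$, for almost every $t$, $\frac{d}{dt}F(c(t))=M\dot c(t)$ for all $M\in\mathcal{J}_F(c(t))$. $F$ is path differentiable if it is locally Lipschitz and admits a conservative Jacobian. Jacobians of maps of $(\theta,z)$, $z\in\mathbb{R}^{n+m}$, are written $[U\ V]$ with $U$ the $\theta$-block and $V$ the $z$-block of the joint Jacobian. *)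

(* Defs.v *)
From HB Require Import structures.
From mathcomp Require Import all_boot all_order all_algebra.
From mathcomp Require Import all_classical all_reals all_analysis.
Set Implicit Arguments. Unset Strict Implicit. Unset Printing Implicit Defensive.
Import Order.TTheory GRing.Theory Num.Theory.
Import numFieldNormedType.Exports.
Local Open Scope classical_set_scope.
Local Open Scope ring_scope.

Section Defs.
Variable R : realType.

Definition dotv n (u v : 'rV[R]_n) : R := \sum_i u 0 i * v 0 i.
Definition enorm n (u : 'rV[R]_n) : R := Num.sqrt (dotv u u).

(* operator norm (Euclidean) of K : R^n -> R^m, x |-> K x (columns), i.e. row x |-> x *m K^T *)
Definition opnorm m n (K : 'M[R]_(m, n)) : R :=
  sup [set enorm (x *m K^T) | x in [set x : 'rV[R]_n | enorm x <= 1]].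

Definition proper_fun n (g : 'rV[R]_n -> \bar R) :=
  (forall x, g x != -oo%E) /\ exists x, g x \is a fin_num.

Definition closed_fun n (g : 'rV[R]_n -> \bar R) :=
  closed [set q : 'rV[R]_n * R | (g q.1 <= q.2%:E)%E].

Definition strongly_convex n (a : R) (g : 'rV[R]_n -> \bar R) :=
  forall (x y : 'rV[R]_n) (t : R), 0 < t < 1 ->
    (g ((t *: x + (1 - t) *: y)%R) <=
      t%:E * g x + (1 - t)%:E * g y - (a / 2 * t * (1 - t) * enorm (x - y) ^+ 2)%:E)%E.

(* prox_g(x) = argmin_u g(u) + 1/2 |x-u|^2 (selected by choice; unique for
   closed proper strongly convex g) *)
Definition is_prox n (g : 'rV[R]_n -> \bar R) (x u : 'rV[R]_n) :=
  forall w, (g u + (enorm (x - u) ^+ 2 / 2)%:E <= g w + (enorm (x - w) ^+ 2 / 2)%:E)%E.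
Definition prox n (g : 'rV[R]_n -> \bar R) (x : 'rV[R]_n) : 'rV[R]_n :=
  xget 0 [set u | is_prox g x u].

Definition subdiff n (g : 'rV[R]_n -> \bar R) (x : 'rV[R]_n) : set 'rV[R]_n :=
  [set v | g x \is a fin_num /\ forall w, (g x + (dotv v (w - x))%:E <= g w)%E].

Definition lagr m n (g : 'rV[R]_n -> \bar R) (fs : 'rV[R]_m -> \bar R)
  (K : 'M[R]_(m, n)) x y : \bar R :=
  (g x + (dotv (x *m K^T) y)%:E - fs y)%E.
Definition is_saddle m n (g : 'rV[R]_n -> \bar R) (fs : 'rV[R]_m -> \bar R)
  (K : 'M[R]_(m, n)) (x : 'rV[R]_n) (y : 'rV[R]_m) :=
  g x \is a fin_num /\ fs y \is a fin_num /\
  forall x' y', (lagr g fs K x y' <= lagr g fs K x y)%E /\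
                (lagr g fs K x y <= lagr g fs K x' y)%E.

(* Jacobian in column convention: 'M_(k, N), entry (i,j) = d F_i / d z_j *)
Definition jac N k (F : 'rV[R]_N -> 'rV[R]_k) (z : 'rV[R]_N) : 'M[R]_(k, N) :=
  (jacobian F z)^T.

Definition convmx a b (S : set 'M[R]_(a, b)) : set 'M[R]_(a, b) :=
  [set M | exists (k : nat) (l : 'I_k -> R) (Ms : 'I_k -> 'M[R]_(a, b)),
     (forall i, 0 <= l i) /\ \sum_i l i = 1 /\ (forall i, S (Ms i)) /\
     M = \sum_i l i *: Ms i].

Definition clarke N k (F : 'rV[R]_N -> 'rV[R]_k) (z : 'rV[R]_N) : set 'M[R]_(k, N) :=
  convmx [set M | exists u : nat -> 'rV[R]_N,
     u @ \oo --> z /\ (forall j, differentiable F (u j)) /\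
     (fun j => jac F (u j)) @ \oo --> M].

Definition loc_lipschitz_on N k (D : set 'rV[R]_N) (F : 'rV[R]_N -> 'rV[R]_k) :=
  forall z, D z -> exists r : R, exists L : R, 0 < r /\
    forall a b, ball z r a -> ball z r b -> `|F a - F b| <= L * `|a - b|.

Definition abs_cont_curve N (c : R -> 'rV[R]_N) :=
  forall e : R, 0 < e -> exists d : R, 0 < d /\
    forall (k : nat) (a b : 'I_k -> R),
      (forall i, 0 <= a i /\ a i <= b i /\ b i <= 1) ->
      (forall i j : 'I_k, (i < j)%N -> b i <= a j) ->
      \sum_i (b i - a i) < d -> \sum_i `|c (b i) - c (a i)| < e.

Definition conservative_on N k (D : set 'rV[R]_N) (F : 'rV[R]_N -> 'rV[R]_k)
  (J : 'rV[R]_N -> set 'M[R]_(k, N)) :=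
  (forall z, D z -> J z !=set0) /\
  (forall z, D z -> exists b : R,
      \forall z' \near z, forall M, J z' M -> `|M| <= b) /\
  (forall (u : nat -> 'rV[R]_N) (Ms : nat -> 'M[R]_(k, N)) z M,
      D z -> (forall j, D (u j)) -> (forall j, J (u j) (Ms j)) ->
      u @ \oo --> z -> Ms @ \oo --> M -> J z M) /\
  (forall c : R -> 'rV[R]_N, abs_cont_curve c ->
     (forall t, 0 <= t <= 1 -> D (c t)) ->
     {ae lebesgue_measure, forall t, `[0, 1]%classic t ->
        derivable c t 1 /\ derivable (F \o c) t 1 /\
        forall M, J (c t) M -> 'D_1 (F \o c) t = 'D_1 c t *m M^T}).

Definition path_diff_on N k (D : set 'rV[R]_N) (F : 'rV[R]_N -> 'rV[R]_k) :=
  loc_lipschitz_on D F /\ exists J, conservative_on D F J.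

(* T(theta,u,v) = (prox_{gamma g_theta}(u), prox_{gamma fs_theta}(v)),
   joint variable w = (theta, u, v) = row_mx theta (row_mx u v) *)
Definition Tmap p n m (gam : R) (g : 'rV[R]_p -> 'rV[R]_n -> \bar R)
  (fs : 'rV[R]_p -> 'rV[R]_m -> \bar R) (w : 'rV[R]_(p + (n + m))) : 'rV[R]_(n + m) :=
  row_mx (prox (fun u => (gam%:E * g (lsubmx w) u)%E) (lsubmx (rsubmx w)))
         (prox (fun v => (gam%:E * fs (lsubmx w) v)%E) (rsubmx (rsubmx w))).

Definition Bmap p n m (K : 'rV[R]_p -> 'M[R]_(m, n))
  (w : 'rV[R]_(p + (n + m))) : 'rV[R]_(n + m) :=
  row_mx (rsubmx (rsubmx w) *m K (lsubmx w))
         (- (lsubmx (rsubmx w) *m (K (lsubmx w))^T)).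

End Defs.

(* Main.v *)
(* The saddle point is the fixed point of the forward-backward step
   z |-> T(theta, z - gamma B(theta, z)), which is a contraction because T is
   1/(1 + gamma alpha)-Lipschitz in z and Id - gamma B is
   sqrt(1 + gamma^2 beta^2)-Lipschitz (B is skew in z).  Differentiating the
   fixed-point equation along a curve yields the formula, once the Clarke
   Jacobian of a path differentiable map F is known to be conservative.  For the
   latter, let J be any conservative Jacobian of F: the mean value inequality
   along segments shows that every directional value M d, with M in the Clarke
   Jacobian at z, lies coordinatewise between the extreme values of J(z) d, and
   these coincide for almost every point of a curve with velocity d. *)
Require Import Defs.
From HB Require Import structures.
From mathcomp Require Import all_boot all_order all_algebra.
From mathcomp Require Import all_classical all_reals all_analysis.
From mathcomp Require Import measurable_realfun.
From mathcomp Require Import ring lra.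
Set Implicit Arguments. Unset Strict Implicit. Unset Printing Implicit Defensive.
Import Order.TTheory GRing.Theory Num.Theory.
Import numFieldNormedType.Exports.
Local Open Scope classical_set_scope.
Local Open Scope ring_scope.

(** Limits and convex hulls preserve upper bounds on linear functionals of a matrix. Every estimate
    on a Clarke Jacobian is therefore reached through [dotv (v *m M^T) y <= b], derived from
    one-sided increments of the map; norm bounds are recovered by testing against enough [y]. This
    also settles the blocks: the limits that define the joint Clarke Jacobian move [theta] too, so
    [V] is not a Clarke Jacobian in [z] alone, but increments in direction [(0, h)] keep [theta]
    fixed, and the Lipschitz constants involved are uniform over [Theta]. Two properties of the
    Clarke Jacobian cost most of the work. It is nonempty because [F] is differentiable wherever [J]
    is single-valued, and such points are dense. Its graph is closed because the number of terms in
    the convex combinations can be bounded by the dimension, so that weights and matrices have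
    convergent subsequences. Topology and Lipschitz constants of maps use the sup norm, while
    contraction holds in the Euclidean norm; factors [1 + n] convert between them. *)

(** * A mean value inequality on the real line from an almost everywhere bound *)

(** Continuous induction on [[0, 1]]. The bad times lie in an open set [G] of measure at most [e].
    From a time outside [G] the increment over a short step has slope at most [C + e]; inside [G]
    the Lipschitz bound is paid for by the growth of [m], the measure of [G] up to [x], and the
    total payment is at most [K * e]. *)
Lemma ae_derive1_le_increment (R : realType) (h : R -> R) (L C : R) :
  (forall s t, 0 <= s <= 1 -> 0 <= t <= 1 -> `|h s - h t| <= L * `|s - t|) ->
  {ae lebesgue_measure, forall t, `[0, 1]%classic t ->
     derivable h t 1 /\ 'D_1 h t <= C} ->
  h 1 - h 0 <= C.
Proof.
move=> hL hae.
have L0 : 0 <= L.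
  have := hL 1 0; rewrite subr0 normr1 mulr1 !lexx ler01 => /(_ isT isT).
  exact: le_trans.
suff key e : 0 < e -> h 1 - h 0 <= C + e + (L + `|C|) * e.
  apply/ler_addgt0Pl => e e0.
  have K0 : 0 < 1 + (L + `|C|) by rewrite ltr_pwDl// addr_ge0.
  have := key (e / (1 + (L + `|C|))); rewrite divr_gt0// => /(_ isT).
  move=> /le_trans; apply.
  rewrite -addrA [leRHS]addrC lerD2l -[X in X + _]mul1r -mulrDl mulrC divfK//.
  by rewrite gt_eqF.
move=> e0.
(* Over a stretch of length [d] inside [G] the right side of [P] grows by at least [(C + e + K) d];
   this choice of [K] makes that at least [L d] even when [C] is negative. *)
set K := L + `|C|.
have K0 : 0 <= K by rewrite addr_ge0.
pose mu := @lebesgue_measure R.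
have [G [oO NO muO]] : exists G : set R, [/\ open G,
    ~` [set t | `[0, 1]%classic t -> derivable h t 1 /\ 'D_1 h t <= C] `<=` G
    & (mu G <= e%:E)%E].
  have /negligible_outer_measure N0 := hae.
  have [G [oO NO]] := outer_measure_open_le
    (~` [set t | `[0, 1]%classic t -> derivable h t 1 /\ 'D_1 h t <= C]) e0.
  by rewrite N0 add0e; exists G.
have mO : measurable G by exact: open_measurable.
pose A x := G `&` `]0, x]%classic.
have mA x : measurable (A x) by apply: measurableI.
pose m x := fine (mu (A x)).
have mfin x : mu (A x) \is a fin_num.
  rewrite ge0_fin_numE ?measure_ge0//; apply: (@le_lt_trans _ _ e%:E); last by rewrite ltry.
  by apply: le_trans muO; apply: le_measure; rewrite ?inE; [exact: mA|exact: mO|exact: subIsetl].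
have m_le x y : x <= y -> m x <= m y.
  move=> xy; apply: fine_le => //; apply: le_measure; rewrite ?inE; [exact: mA|exact: mA|].
  apply: setIS => z /=; rewrite !in_itv/= => /andP[-> /le_trans]; exact.
have m_e x : m x <= e.
  rewrite -lee_fin /m fineK//; apply: le_trans muO.
  by apply: le_measure; rewrite ?inE; [exact: mA|exact: mO|exact: subIsetl].
have m_add x y : 0 <= x -> x <= y -> `]x, y]%classic `<=` G -> m x + (y - x) <= m y.
  move=> x0 xy xyO; rewrite -lee_fin /m EFinD !fineK//.
  have -> : (y - x)%:E = mu `]x, y]%classic.
    rewrite /mu lebesgue_measure_itv/= lte_fin; move: xy; rewrite le_eqVlt => /predU1P[->|->//].
    by rewrite ltxx subrr.
  rewrite -measureU//.
  - apply: le_measure; rewrite ?inE; [by apply: measurableU; [exact: mA|exact: measurable_itv]|exact: mA|].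
    move=> z [[Oz]|zxy] /=; first by rewrite in_itv/= => /andP[z0 zx]; split => //=; rewrite in_itv/= z0 (le_trans zx).
    split; first exact: xyO.
    by move: zxy; rewrite /= !in_itv/= => /andP[/(le_lt_trans x0)-> ->].
  - exact: mA.
  - apply/seteqP; split => // z [[_ /=]]; rewrite !in_itv/= => /andP[_ zx] /andP[+ _].
    by rewrite ltNge zx.
pose P x := h x - h 0 <= (C + e) * x + K * m x.
pose S := [set x | 0 <= x <= 1 /\ P x].
have m0 : 0 <= m 0 by rewrite fine_ge0.
have S0 : S 0 by split; [rewrite lexx ler01|rewrite /P subrr mulr0 add0r mulr_ge0].
have ubS : has_ubound S by exists 1 => x [/andP[_ ]].
have supS1 : sup S <= 1 by apply: ge_sup; [exists 0|move=> x [/andP[]]].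
have supS0 : 0 <= sup S by exact: ub_le_sup.
(* The inequality passes to the supremum by the Lipschitz bound on [h] and the monotonicity of
   [m]. *)
have PS : P (sup S).
  apply/ler_addgt0Pl => d d0.
  have d'0 : 0 < d / (1 + (L + `|C + e|)) by rewrite divr_gt0// ltr_pwDl// addr_ge0.
  have [x [/andP[x0 x1] Px] xS] := sup_adherent d'0 (conj (ex_intro _ 0 S0) ubS : has_sup S).
  have xleS : x <= sup S by apply: ub_le_sup => //; split => //; rewrite x0.
  have mx := m_le _ _ xleS.
  have hx : h (sup S) - h x <= L * (sup S - x).
    rewrite -[X in _ <= _ * X]ger0_norm ?subr_ge0//.
    apply: le_trans (hL _ _ _ _); rewrite ?ler_norm ?x0 ?supS0//.
  have Kmx : K * m x <= K * m (sup S) by rewrite ler_wpM2l.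
  have Cx : (C + e) * x - (C + e) * sup S <= `|C + e| * (sup S - x).
    by rewrite -mulrBr (le_trans (ler_norm _))// normrM ler_wpM2l// distrC ger0_norm ?subr_ge0.
  have dx : (L + `|C + e|) * (sup S - x) <= d.
    apply: (@le_trans _ _ ((1 + (L + `|C + e|)) * (sup S - x))).
      by apply: ler_wpM2r; rewrite ?subr_ge0// lerDr.
    rewrite mulrC -ler_pdivlMr ?ltr_pwDl ?addr_ge0//.
    by rewrite lerBlDl -lerBlDr ltW.
  move: Px hx Kmx Cx dx; rewrite /P mulrDl; lra.
have [S1|] := ltP (sup S) 1; last first.
  move=> S1; have S1' : sup S = 1 by apply/eqP; rewrite eq_le supS1.
  move: PS; rewrite S1' /P mulr1 => /le_trans; apply.
  by rewrite lerD2l ler_wpM2l.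
(* If [sup S < 1], any extension of [P] beyond the supremum is a contradiction. *)
suff [y yS1 Py] : exists2 y, sup S < y <= 1 & P y.
  case/andP: yS1 => yS y1.
  have : y <= sup S by apply: ub_le_sup => //; split=> //; rewrite y1 (le_trans supS0 (ltW yS)).
  by rewrite leNgt yS.
have [OS|nOS] := pselect (G (sup S)).
  have : \forall y \near (sup S), G y by exact: open_nbhs_nbhs.
  move=> /nbhs_ballP[r /= r0 rO].
  pose y := Num.min 1 (sup S + r / 2).
  have yS : sup S < y by rewrite lt_min S1 ltrDl divr_gt0.
  have y1 : y <= 1 by rewrite ge_min lexx.
  have y0 : 0 <= y by rewrite (le_trans supS0 (ltW yS)).
  exists y; first by rewrite yS.
  have my : m (sup S) + (y - sup S) <= m y.
    apply: m_add => //; first exact: ltW.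
    move=> z /=; rewrite in_itv/= => /andP[zS zy]; apply: rO.
    rewrite /ball/= ltr0_norm ?subr_lt0// opprB ltrBlDl (le_lt_trans zy)//.
    rewrite (@le_lt_trans _ _ (sup S + r / 2)) ?ge_min ?lexx ?orbT//.
    by rewrite ltrD2l ltr_pdivrMr// ltr_pMr// ltr1n.
  have hy : h y - h (sup S) <= L * (y - sup S).
    rewrite -[X in _ <= _ * X]ger0_norm ?subr_ge0 ?(ltW yS)//.
    by apply: le_trans (hL _ _ _ _); rewrite ?ler_norm ?y0 ?supS0.
  have Kmy : K * (m (sup S) + (y - sup S)) <= K * m y by rewrite ler_wpM2l.
  have Cy : - C * (y - sup S) <= `|C| * (y - sup S).
    by rewrite ler_wpM2r ?subr_ge0 ?(ltW yS)// -normrN ler_norm.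
  have ey : 0 <= e * (y - sup S) by rewrite mulr_ge0 ?subr_ge0 ?(ltW yS, ltW e0).
  move: PS hy Kmy Cy ey; rewrite /P /K mulrDr !mulrDl !mulrBr !mulNr; lra.
have [dh dC] : derivable h (sup S) 1 /\ 'D_1 h (sup S) <= C.
  apply: contrapT => nd; apply: nOS; apply: NO => /=.
  by move=> /(_ _)H; apply: nd; apply: H; rewrite /= in_itv/= supS0 supS1.
have /cvgrPdist_lt/(_ e e0) [r /= r0 rD] := dh.
pose t := Num.min (1 - sup S) (r / 2).
have t0 : 0 < t by rewrite lt_min subr_gt0 S1 divr_gt0.
have tr : t < r.
  by rewrite (@le_lt_trans _ _ (r / 2)) ?ge_min ?lexx ?orbT// ltr_pdivrMr// ltr_pMr// ltr1n.
have t1 : sup S + t <= 1 by rewrite -lerBrDl ge_min lexx.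
exists (sup S + t); first by rewrite ltrDl t0.
have := rD t; rewrite /ball_/= sub0r normrN gtr0_norm// tr gt_eqF// => /(_ isT isT).
rewrite -/('D_1 h (sup S)) [t%:A]mulr1 [t + _]addrC distrC.
move=> /ltW /(le_trans (ler_norm _)); rewrite lerBlDr => ht.
have {}ht : h (sup S + t) - h (sup S) <= t * (e + C).
  by rewrite -ler_pdivrMl// (le_trans ht)// lerD2l.
have Kt : K * m (sup S) <= K * m (sup S + t) by rewrite ler_wpM2l ?m_le// lerDl ltW.
move: PS; rewrite /P; lra.
Qed.

(** * Completeness, compactness and subsequences of matrices *)

(** Together with the norm, this makes row vectors a complete normed module, the setting of the
    Baire argument below. *)
HB.instance Definition _ (R : realType) (m n : nat) :=
  Uniform_isComplete.Build 'M[R]_(m, n) (@mx_complete R m n).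

Lemma mx_norm_ge_coord (R : realType) m n (M : 'M[R]_(m, n)) i j : `|M i j| <= `|M|.
Proof. by rewrite [leRHS]/Num.Def.normr/= mx_normrE; exact: (le_bigmax _ _ (i, j)). Qed.

Lemma mx_norm_le_coord (R : realType) m n (M : 'M[R]_(m, n)) b :
  0 <= b -> (forall i j, `|M i j| <= b) -> `|M| <= b.
Proof. by move=> b0 Mb; rewrite [leLHS]/Num.Def.normr/= mx_normrE bigmax_le// => -[]. Qed.

Lemma compact_mx_ball (R : realType) m n (b : R) :
  compact [set M : 'M[R]_(m, n) | `|M| <= b].
Proof.
have [b0|b0] := ltP b 0.
  rewrite (_ : mkset _ = set0); first exact: compact0.
  by apply/seteqP; split => // M /=; rewrite leNgt (lt_le_trans b0).
rewrite (_ : mkset _ = vec_mx @` [set v : 'rV[R]_(m * n) | `|v| <= b]); last first.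
  apply/seteqP; split => [M /= Mb|_ [v /= vb <-]].
    exists (mxvec M); last exact: mxvecK.
    apply: mx_norm_le_coord => // i j; rewrite ord1.
    by case/mxvec_indexP: j => i' j'; rewrite mxvecE (le_trans (mx_norm_ge_coord _ _ _)).
  by apply: mx_norm_le_coord => // i j; rewrite mxE (le_trans (mx_norm_ge_coord _ _ _)).
have vc : continuous (vec_mx : 'rV[R]_(m * n) -> 'M[R]_(m, n)).
  move=> v; apply/(@cvgrPdist_le _ _ _ (nbhs v) (nbhs_filter v)) => e e0.
  apply/nbhs_ballP; exists e => //= w; rewrite -ball_normE/= => /ltW vw.
  rewrite -linearB; apply: mx_norm_le_coord; first exact: ltW.
  by move=> i j; rewrite mxE (le_trans (mx_norm_ge_coord _ _ _)).
apply: continuous_compact; first exact: continuous_subspaceT.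
apply: bounded_closed_compact; first by exists b; split=> [|x bx v /= /le_trans]; [exact: num_real|apply; exact: ltW].
apply: (@closed_comp _ _ (fun v : 'rV[R]_(m * n) => `|v|) [set x | x <= b]) => [v _|]; last exact: closed_le.
exact: norm_continuous.
Qed.

(** The index map is only asked to dominate the identity, not to increase strictly: this suffices to
    inherit limits ([cvg_subseq]) and is stable under composition. *)
Lemma bounded_cvg_subseq (R : realType) m n (u : nat -> 'M[R]_(m, n)) b :
  (forall k, `|u k| <= b) ->
  exists2 f : nat -> nat, (forall k, (k <= f k)%N) & cvgn (u \o f).
Proof.
move=> ub.
have [M [_ Mcl]] : [set M : 'M[R]_(m, n) | `|M| <= b] `&` cluster (u @ \oo) !=set0.
  by apply: compact_mx_ball; exists 0%N => // k _; exact: ub.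
have /choice[f fP] : forall k, exists j, (k <= j)%N /\ `|M - u j| < k.+1%:R^-1.
  move=> k.
  have k0 : 0 < k.+1%:R^-1 :> R by rewrite invr_gt0.
  have tail : (u @ \oo) [set u j | j in [set j | (k <= j)%N]].
    by exists k => // j /= kj; exists j.
  have [_ [[j kj <-]]] := Mcl _ _ tail (nbhsx_ballx M _ k0).
  by rewrite -ball_normE => Mj; exists j.
exists f; first by move=> k; have [] := fP k.
apply/cvg_ex; exists M; apply/cvgrPdist_lt => e e0; near=> k => /=.
have [_ /lt_trans] := fP k; apply.
by near: k; exact: near_infty_natSinv_lt (PosNum e0).
Unshelve. all: by end_near. Qed.

Lemma cvg_subseq (T : topologicalType) (u : nat -> T) (f : nat -> nat) (l : T) :
  (forall k, (k <= f k)%N) -> u @ \oo --> l -> (u \o f) @ \oo --> l.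
Proof.
move=> fk ul A /ul[N _ NA].
by exists N => // k /= Nk; apply: NA => /=; exact: leq_trans Nk (fk k).
Qed.

(** * Conservative Jacobians along segments, and points of differentiability *)

Lemma loc_lipschitz_ball (R : realType) N k (D : set 'rV[R]_N) (F : 'rV[R]_N -> 'rV[R]_k) z :
  open D -> loc_lipschitz_on D F -> D z ->
  exists r L, [/\ 0 < r, 0 <= L, ball z r `<=` D &
    forall a b, ball z r a -> ball z r b -> `|F a - F b| <= L * `|a - b|].
Proof.
move=> oD lF Dz; have [r [L [r0 FL]]] := lF z Dz.
have [s /= s0 sD] : exists2 s : R, 0 < s & ball z s `<=` D.
  by have /nbhs_ballP[s] := open_nbhs_nbhs (conj oD Dz); exists s.
exists (Num.min r s), (Num.max 0 L); split.
- by rewrite lt_min r0 s0.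
- by rewrite le_max lexx.
- by move=> x /(le_ball _) xs; apply: sD; apply: xs; rewrite ge_min lexx orbT.
- move=> a b ra rb; apply: (@le_trans _ _ (L * `|a - b|)).
    by apply: FL; [move: ra|move: rb]; apply: le_ball; rewrite ge_min lexx.
  by rewrite ler_wpM2r// le_max lexx orbT.
Qed.

Lemma lipschitz_abs_cont (R : realType) N (c : R -> 'rV[R]_N) L :
  (forall s t, 0 <= s <= 1 -> 0 <= t <= 1 -> `|c s - c t| <= L * `|s - t|) ->
  abs_cont_curve c.
Proof.
move=> cL e e0; have L0 : 0 < 1 + `|L| by rewrite ltr_pwDl.
exists (e / (1 + `|L|)); split; first by rewrite divr_gt0.
move=> k a b ab _ sumd; apply: (@le_lt_trans _ _ (\sum_i (1 + `|L|) * (b i - a i))).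
  apply: ler_sum => i _; have [a0 [aib b1]] := ab i.
  apply: le_trans (cL _ _ _ _) _; rewrite ?(a0, b1, le_trans a0 aib, le_trans aib b1)//.
  rewrite ger0_norm ?subr_ge0// ler_wpM2r ?subr_ge0//.
  by rewrite (le_trans (ler_norm _))// lerDr.
by rewrite -mulr_sumr mulrC -ltr_pdivlMr.
Qed.

Lemma ae_imply (R : realType) (P Q : R -> Prop) : (forall t, P t -> Q t) ->
  {ae lebesgue_measure, forall t, P t} -> {ae lebesgue_measure, forall t, Q t}.
Proof. by move=> PQ; apply: negligibleS => t /= nQ /PQ. Qed.

(** The curve [a + t d] has velocity [d] at every time, so each coordinate of [F] along it is
    Lipschitz with almost everywhere derivative [d *m M^T] for any [M] in [J]; the one-dimensional
    inequality applies. *)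
Lemma conservative_segment (R : realType) N k (D : set 'rV[R]_N) F
    (J : 'rV[R]_N -> set 'M[R]_(k, N)) (a d : 'rV[R]_N) L C i :
  conservative_on D F J ->
  (forall t, 0 <= t <= 1 -> D (a + t *: d)) ->
  (forall s t, 0 <= s <= 1 -> 0 <= t <= 1 ->
    `|F (a + s *: d) - F (a + t *: d)| <= L * `|s - t|) ->
  (forall t M, 0 <= t <= 1 -> J (a + t *: d) M -> (d *m M^T) 0 i <= C) ->
  F (a + d) 0 i - F a 0 i <= C.
Proof.
move=> [J0 [_ [_ Jc]]] Dad FL JC.
pose c t := a + t *: d.
have cA : abs_cont_curve c.
  apply: (@lipschitz_abs_cont _ _ _ `|d|) => s t _ _.
  by rewrite /c opprD addrACA subrr add0r -scalerBl normrZ mulrC.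
have := @ae_derive1_le_increment _ (fun t => F (c t) 0 i) L C.
rewrite /c scale1r scale0r addr0; apply.
  move=> s t s01 t01; apply: le_trans (FL s t s01 t01).
  by apply: le_trans (mx_norm_ge_coord _ 0 i); rewrite !mxE.
apply: ae_imply (Jc c cA Dad) => t Ht t01.
have [dc [dF Mt]] := Ht t01.
have dcd : 'D_1 c t = d.
  rewrite /c; apply: cvg_lim => //; apply: cvg_near_cst; near=> s.
  have s0 : s != 0 by near: s; exact: nbhs_dnbhs_neq.
  by rewrite /= opprD addrACA subrr add0r -scalerBl addrK scalerA [s%:A]mulr1 mulVf// scale1r.
split; first by move/derivable_mxP : dF => /(_ 0 i).
have [t0 t1] : 0 <= t /\ t <= 1 by move: t01; rewrite /= in_itv/= => /andP[].
have t01' : 0 <= t <= 1 by rewrite t0.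
have [M JM] := J0 _ (Dad t t01').
have := Mt M JM; rewrite dcd derive_mx// => /matrixP/(_ 0 i); rewrite mxE => ->.
exact: JC JM.
Unshelve. all: by end_near. Qed.

(** A closed graph and local boundedness give upper semicontinuity: matrices of [J] outside [P] at
    points tending to [z] would have a limit in [J z], hence in the open set [P]. *)
Lemma conservative_usc (R : realType) N k (D : set 'rV[R]_N) F
    (J : 'rV[R]_N -> set 'M[R]_(k, N)) P z :
  open D -> conservative_on D F J -> D z -> open P -> J z `<=` P ->
  \forall z' \near z, J z' `<=` P.
Proof.
move=> oD [_ [Jb [Jg _]]] Dz oP JP; apply: contrapT => nP.
have [b /nbhs_ballP[r /= r0 rb]] := Jb z Dz.
have /nbhs_ballP[s /= s0 sD] : nbhs z D by exact: open_nbhs_nbhs.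
have /choice[u uP] : forall j : nat, exists zM : 'rV[R]_N * 'M[R]_(k, N),
    [/\ ball z j.+1%:R^-1 zM.1, D zM.1, `|zM.2| <= b, J zM.1 zM.2 & ~ P zM.2].
  move=> j; apply: contrapT => nz; apply: nP.
  pose d := Num.min j.+1%:R^-1 (Num.min r s).
  have d0 : 0 < d by rewrite !lt_min invr_gt0 ltr0n r0 s0.
  apply/nbhs_ballP; exists d => //= z' dz' M JM; apply: contrapT => nPM; apply: nz.
  have rz' : ball z r z' by apply: le_ball dz'; rewrite !ge_min lexx !orbT.
  exists (z', M); split => //=; last exact: rb rz' _ JM.
    by apply: le_ball dz'; rewrite ge_min lexx.
  by apply: sD; apply: le_ball dz'; rewrite !ge_min lexx !orbT.
have [f fk /cvg_ex[M fM]] : exists2 f : nat -> nat, (forall k, (k <= f k)%N)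
    & cvgn ((fun j => (u j).2) \o f).
  by apply: (@bounded_cvg_subseq _ _ _ _ b) => j; have [] := uP j.
have uz : (fun j => (u j).1) @ \oo --> z.
  apply/cvgrPdist_lt => e e0; near=> j.
  have [+ _ _ _ _] := uP j; rewrite -ball_normE => /lt_trans; apply.
  by near: j; exact: near_infty_natSinv_lt (PosNum e0).
have : J z M.
  apply: (Jg ((fun j => (u j).1) \o f) ((fun j => (u j).2) \o f)) => //=.
  - by move=> j; have [] := uP (f j).
  - by move=> j; have [] := uP (f j).
  - exact: cvg_subseq.
move=> /JP PM; have : nbhs M P by exact: open_nbhs_nbhs.
move=> /fM[j _ /(_ j (leqnn j))] /=.
by have [] := uP (f j).
Unshelve. all: by end_near. Qed.

Lemma linear_approx_differentiable (R : realType) (V W : normedModType R)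
    (F : V -> W) (df : {linear V -> W}) (z : V) :
  continuous df ->
  (forall e, 0 < e -> \forall v \near (0 : V), `|F (v + z) - F z - df v| <= e * `|v|) ->
  differentiable F z.
Proof.
move=> dfc est.
have FA : F \o shift z = cst (F z) + df +o_ 0 id.
  apply/eqaddoP => e e0; have := est e e0; apply: filterS => v /=.
  by rewrite !fctE /= opprD addrA.
by apply/diff_locallyP; rewrite (diff_unique dfc FA); split.
Qed.

Lemma differentiable_estimate (R : realType) N k (F : 'rV[R]_N -> 'rV[R]_k) (z : 'rV[R]_N)
    (A : 'M[R]_(k, N)) :
  (forall e, 0 < e -> \forall v \near (0 : 'rV[R]_N),
    `|F (v + z) - F z - v *m A^T| <= e * `|v|) ->
  differentiable F z.
Proof.
move=> est.
have Ac : continuous (mulmxr A^T : 'rV[R]_N -> 'rV[R]_k).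
  move=> v; apply/(@cvgrPdist_le _ _ _ (nbhs v) (nbhs_filter v)) => e e0.
  pose c : R := 1 + N%:R * `|A|.
  have c0 : 0 < c by rewrite ltr_pwDl// mulr_ge0.
  apply/nbhs_ballP; exists (e / c) => /=; first by rewrite divr_gt0.
  move=> w; rewrite -ball_normE/= => vw.
  rewrite -mulmxBl; apply: mx_norm_le_coord; first exact: ltW.
  move=> i j; rewrite mxE (le_trans (ler_norm_sum _ _ _))//.
  apply: (@le_trans _ _ (\sum_(i < N) (e / c) * `|A|)).
    apply: ler_sum => l _; rewrite normrM ler_pM//.
      by rewrite (le_trans (mx_norm_ge_coord _ _ _))// ltW.
    by rewrite mxE mx_norm_ge_coord.
  rewrite sumr_const card_ord -mulr_natl mulrCA -mulrA ler_piMr ?(ltW e0)//.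
  by rewrite ler_pdivrMl// mulr1 lerDr.
exact: linear_approx_differentiable Ac est.
Qed.

Lemma continuous_mul_tr (R : realType) N k (d : 'rV[R]_N) :
  continuous (fun M : 'M[R]_(k, N) => d *m M^T).
Proof.
move=> M; apply/(@cvgrPdist_le _ _ _ (nbhs M) (nbhs_filter M)) => e e0.
pose c : R := 1 + N%:R * `|d|.
have c0 : 0 < c by rewrite ltr_pwDl// mulr_ge0.
apply/nbhs_ballP; exists (e / c) => /=; first by rewrite divr_gt0.
move=> M'; rewrite -ball_normE/= => /ltW MM'.
rewrite -mulmxBr -linearB; apply: mx_norm_le_coord; first exact: ltW.
move=> i j; rewrite mxE (le_trans (ler_norm_sum _ _ _))//.
apply: (@le_trans _ _ (\sum_(i < N) `|d| * (e / c))).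
  apply: ler_sum => l _; rewrite normrM ler_pM ?mx_norm_ge_coord//.
  by rewrite mxE (le_trans (mx_norm_ge_coord _ _ _)).
rewrite sumr_const card_ord -mulr_natl mulrA mulrCA ler_piMr ?(ltW e0)//.
by rewrite ler_pdivrMr// mul1r lerDr.
Qed.

(** At almost every time all values equal the derivative of [F] along the segment, and [[0, 1]] is
    not a null set. *)
Lemma conservative_segment_eq (R : realType) N k (D : set 'rV[R]_N) F
    (J : 'rV[R]_N -> set 'M[R]_(k, N)) (a d : 'rV[R]_N) :
  conservative_on D F J -> (forall t, 0 <= t <= 1 -> D (a + t *: d)) ->
  exists2 t, 0 <= t <= 1 & forall M M', J (a + t *: d) M -> J (a + t *: d) M' ->
    d *m M^T = d *m M'^T.
Proof.
move=> [_ [_ [_ Jc]]] Dad.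
pose c t := a + t *: d.
have cA : abs_cont_curve c.
  apply: (@lipschitz_abs_cont _ _ _ `|d|) => s t _ _.
  by rewrite /c opprD addrACA subrr add0r -scalerBl normrZ mulrC.
apply: contrapT => nt.
have Qae := Jc c cA Dad.
have N01 : lebesgue_measure.-negligible (`[0, 1]%classic : set R).
  apply: negligibleS Qae => t t01 /= Qt; apply: nt.
  have [_ [_ Mt]] := Qt t01.
  exists t; first by move: t01; rewrite /= in_itv.
  have dcd : 'D_1 c t = d.
    rewrite /c; apply: cvg_lim => //; apply: cvg_near_cst; near=> s.
    have s0 : s != 0 by near: s; exact: nbhs_dnbhs_neq.
    by rewrite /= opprD addrACA subrr add0r -scalerBl addrK scalerA [s%:A]mulr1 mulVf// scale1r.
  by move=> M M' /Mt + /Mt; rewrite dcd => <- <-.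
have : @lebesgue_measure R `[0, 1]%classic = 0%E.
  by apply: measure_negligible N01; exact: measurable_itv.
rewrite lebesgue_measure_itv/= lte_fin ltr01 => /eqP.
by rewrite -EFinB subr0 eqe oner_eq0.
Unshelve. all: by end_near. Qed.

(* Baire category replaces Rademacher's theorem: along lines in a coordinate
   direction [e_j] the set [J z e_j] is a.e. a singleton, so the open sets where
   it has small diameter are dense. *)
Lemma conservative_singleton_dense (R : realType) N k (D : set 'rV[R]_N) F
    (J : 'rV[R]_N -> set 'M[R]_(k, N)) z r :
  open D -> conservative_on D F J -> D z -> 0 < r ->
  exists z' M, [/\ ball z r z', D z' & J z' = [set M]].
Proof.
move=> oD cJ Dz r0.
(* In [W j l] all matrices of [J] send the basis vector [e_j] into one ball of radius [1/(l+1)]. A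
   point in every [W j l] has a single-valued [J]. *)
pose W (j : 'I_N) (l : nat) := [set x | D x /\ exists v : 'rV[R]_k,
  J x `<=` [set M | ball v l.+1%:R^-1 (delta_mx 0 j *m M^T)]].
have oW j l : open (W j l).
  rewrite openE => x [Dx [v Jv]].
  have Dx' : nbhs x D by exact: open_nbhs_nbhs.
  have := conservative_usc oD cJ Dx _ Jv.
  move=> /(_ _) [|/= e e0 eW].
    apply: (@open_comp _ _ (fun M : 'M[R]_(k, N) => delta_mx 0 j *m M^T)).
      by move=> M _; exact: continuous_mul_tr.
    by apply: ball_open; rewrite invr_gt0.
  near=> x'; split; first by near: x'.
  by exists v; near: x'; exists e.
(* Baire requires sets dense in the whole space, so the interior of the complement of [D] is added;
   it contributes no point of [D]. Integers coding no pair get the whole space. *)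
pose G n := if unpickle n is Some jl then W jl.1 jl.2 `|` (~` D)° else setT.
have [x [[Dx rx] Gx]] : (D `&` ball z r) `&` \bigcap_i G i !=set0.
  apply: (@Baire R 'rV[R]_N G).
  - move=> n; rewrite /G; case: unpickle => [[j l]|] /=; last first.
      by split; [exact: openT|move=> U [x Ux] _; exists x].
    split; first by apply: openU; [exact: oW|exact: open_interior].
    move=> U [y Uy] oU.
    have [[y' [Uy' Dy']]|UD] := pselect (U `&` D !=set0); last first.
      exists y; split => //; right; apply: (@filterS _ _ _ U).
        by move=> u Uu Du; apply: UD; exists u.
      exact: open_nbhs_nbhs.
    have /nbhs_ballP[s /= s0 sUD] : nbhs y' (U `&` D) by apply: open_nbhs_nbhs; split=> //; exact: openI.
    pose d : 'rV[R]_N := (s / 2) *: delta_mx 0 j.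
    have sd t : 0 <= t <= 1 -> ball y' s (y' + t *: d).
      move=> /andP[t0 t1]; rewrite -ball_normE/= opprD addrA subrr sub0r normrN.
      have s2 : 0 <= s / 2 by rewrite divr_ge0 ?ltW.
      rewrite normrZ ger0_norm// normrZ (ger0_norm s2).
      have d1 : `|delta_mx 0 j : 'rV[R]_N| <= 1.
        by apply: mx_norm_le_coord => // i i'; rewrite mxE; case: (_ && _); rewrite ?normr1 ?normr0.
      apply: (@le_lt_trans _ _ (s / 2)).
        apply: (@le_trans _ _ (1 * (s / 2 * 1))); last by rewrite mul1r mulr1.
        by apply: ler_pM => //; [apply: mulr_ge0|apply: ler_wpM2l].
      by rewrite ltr_pdivrMr// ltr_pMr// ltr1n.
    (* A short segment in direction [e_j] inside the given open set contains a point where [J e_j]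
       has a single value: this is density. *)
    have [t t01 Jt] := conservative_segment_eq cJ (fun t t01 => (sUD _ (sd t t01)).2).
    have [Ut Dt] := sUD _ (sd t t01).
    exists (y' + t *: d); split => //; left; split => //.
    have [M JM] := cJ.1 _ Dt.
    exists (delta_mx 0 j *m M^T) => M' JM' /=.
    have s20 : s / 2 != 0 by rewrite gt_eqF// divr_gt0.
    have := Jt M M' JM JM'; rewrite /d -!scalemxAl => /(scalerI s20) <-.
    by apply: ballxx; rewrite invr_gt0.
  - by exists z; split => //; exact: ballxx.
  - by apply: openI => //; exact: ball_open.
have [M JM] := cJ.1 _ Dx.
exists x, M; split => //; apply/seteqP; split => [M' JM'|M' ->//].
apply: trmx_inj; apply/row_matrixP => j; rewrite !rowE.
apply/eqP; rewrite -subr_eq0 -normr_le0; apply/ler_addgt0Pl => e e0; rewrite addr0.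
have [l _ le] := near_infty_natSinv_lt (PosNum (divr_gt0 e0 (ltr0n _ 2))).
have := Gx (pickle (j, l)) I; rewrite /G pickleK /= => -[[_ [v Jv]]|]; last first.
  by move=> /interior_subset.
have := Jv _ JM; have := Jv _ JM'; rewrite /= -!ball_normE/= => vM' vM.
have := le l (leqnn _); rewrite /= => le2.
rewrite -(subrK v (delta_mx 0 j *m M'^T)) -addrA (le_trans (ler_normD _ _))//.
by rewrite distrC [leRHS]splitr lerD// ltW// (lt_trans _ le2).
Unshelve. all: by end_near. Qed.

Lemma mulmx_tr_coord_le (R : realType) N k (d : 'rV[R]_N) (M : 'M[R]_(k, N)) i :
  `|(d *m M^T) 0 i| <= N%:R * `|d| * `|M|.
Proof.
rewrite mxE (le_trans (ler_norm_sum _ _ _))//.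
apply: (@le_trans _ _ (\sum_(i < N) `|d| * `|M|)).
  by apply: ler_sum => l _; rewrite normrM ler_pM// ?mxE mx_norm_ge_coord.
by rewrite sumr_const card_ord -[in leLHS]mulr_natl mulrA.
Qed.

Lemma ball_segment (R : realType) N (z a d : 'rV[R]_N) r t :
  ball z r a -> ball z r (a + d) -> 0 <= t <= 1 -> ball z r (a + t *: d).
Proof.
rewrite -ball_normE/= => za zd /andP[t0 t1].
have -> : z - (a + t *: d) = (1 - t) *: (z - a) + t *: (z - (a + d)).
  by apply/matrixP => i j; rewrite !mxE; ring.
apply: (le_lt_trans (ler_normD _ _)); rewrite !normrZ (ger0_norm t0) ger0_norm ?subr_ge0//.
have [->|t_neq0] := eqVneq t 0; first by rewrite subr0 mul1r mul0r addr0.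
have t_gt0 : 0 < t by rewrite lt0r t_neq0.
have -> : r = (1 - t) * r + t * r by ring.
by rewrite ler_ltD// ?ltr_pM2l// ler_wpM2l ?subr_ge0// ltW.
Qed.

Lemma conservative_ball_le (R : realType) N k (D : set 'rV[R]_N) F
    (J : 'rV[R]_N -> set 'M[R]_(k, N)) (z a d : 'rV[R]_N) r L C i :
  conservative_on D F J -> ball z r `<=` D ->
  (forall a b, ball z r a -> ball z r b -> `|F a - F b| <= L * `|a - b|) ->
  ball z r a -> ball z r (a + d) ->
  (forall x M, ball z r x -> J x M -> (d *m M^T) 0 i <= C) ->
  F (a + d) 0 i - F a 0 i <= C.
Proof.
move=> cJ rD FL ra rad JC; have seg t := ball_segment ra rad (t := t).
apply: (conservative_segment (L := L * `|d|) cJ).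
- by move=> t /seg /rD.
- move=> s t /seg rs /seg rt; apply: le_trans (FL _ _ rs rt) _.
  by rewrite opprD addrACA subrr add0r -scalerBl normrZ [`|s - t| * _]mulrC mulrA.
- by move=> t M /seg; exact: JC.
Qed.

(** Near [z] all values of [J] are close to [A], so the mean value inequality makes [A] a
    first-order approximation of [F]. *)
Lemma conservative_singleton_differentiable (R : realType) N k (D : set 'rV[R]_N)
    (F : 'rV[R]_N -> 'rV[R]_k) (J : 'rV[R]_N -> set 'M[R]_(k, N)) z A :
  open D -> loc_lipschitz_on D F -> conservative_on D F J -> D z ->
  J z = [set A] -> differentiable F z.
Proof.
move=> oD lF cJ Dz JA; apply: (differentiable_estimate (A := A)) => e e0.
have [r [L [r0 L0 rD FL]]] := loc_lipschitz_ball oD lF Dz.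
pose eta := e / (1 + N%:R); have c0 : 0 < 1 + N%:R :> R by rewrite ltr_pwDl.
have eta0 : 0 < eta by rewrite divr_gt0.
have : \forall z' \near z, J z' `<=` ball A eta.
  apply: (conservative_usc oD cJ Dz); first exact: ball_open.
  by rewrite JA => _ ->; exact: ballxx.
move=> /nbhs_ballP[s /= s0 sJ].
pose q := Num.min r s; have q0 : 0 < q by rewrite lt_min r0.
have qr : ball z q `<=` ball z r by apply: le_ball; rewrite ge_min lexx.
have qs : ball z q `<=` ball z s by apply: le_ball; rewrite ge_min lexx orbT.
have main a d i : ball z q a -> ball z q (a + d) ->
    F (a + d) 0 i - F a 0 i <= (d *m A^T) 0 i + e * `|d|.
  move=> qa qad; apply: (conservative_ball_le (r := q) cJ _ _ qa qad).
  - by apply: subset_trans rD.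
  - by move=> x y /qr xr /qr yr; exact: FL.
  move=> x M /qs /sJ JM /JM; rewrite -ball_normE/= => /ltW AM.
  rewrite -lerBlDl (_ : _ - _ = (d *m (M - A)^T) 0 i); last by rewrite linearB mulmxBr !mxE.
  rewrite (le_trans (ler_norm _))// (le_trans (mulmx_tr_coord_le _ _ _))//.
  apply: (@le_trans _ _ (N%:R * `|d| * eta)); first by rewrite distrC ler_wpM2l ?mulr_ge0.
  rewrite /eta mulrAC ler_wpM2r// mulrC -mulrA ler_piMr ?(ltW e0)//.
  by rewrite mulrC ler_pdivrMr// mul1r lerDr.
apply/nbhs_ballP; exists q => //= v; rewrite -ball_normE/= sub0r normrN => vq.
have qz : ball z q z by exact: ballxx.
have qvz : ball z q (z + v) by rewrite -ball_normE/= opprD addrA subrr sub0r normrN.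
apply: mx_norm_le_coord; first by rewrite mulr_ge0 ?(ltW e0).
move=> i0 i; rewrite (ord1 i0) addrC [v + z]addrC ler_norml; apply/andP; split.
  (* The lower bound is the upper bound for the reversed segment. *)
  have := main (z + v) (- v) i qvz; rewrite addrK normrN => /(_ qz).
  by rewrite mulNmx !mxE; lra.
by have := main z v i qz qvz; rewrite !mxE; lra.
Qed.

(** * Linear bounds on the Clarke Jacobian, and its nonemptiness *)

Lemma cvg_mx_coord (R : realType) (T : Type) (F : set_system T) {FF : Filter F}
    m n (f : T -> 'M[R]_(m, n)) (l : 'M[R]_(m, n)) i j :
  f @ F --> l -> (fun x => f x i j) @ F --> l i j.
Proof. by move=> fl; apply: (@cvg_comp _ _ _ f (fun M : 'M[R]_(m, n) => M i j) F (nbhs l)) => //; exact: coord_continuous. Qed.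

Lemma cvg_dotv (R : realType) (T : Type) (F : set_system T) {FF : Filter F}
    n (u v : T -> 'rV[R]_n) (a b : 'rV[R]_n) :
  u @ F --> a -> v @ F --> b -> dotv (u x) (v x) @[x --> F] --> dotv a b.
Proof.
move=> ua vb; apply: cvg_big => [|i _]; first exact: add_continuous.
by apply: cvgM; exact: cvg_mx_coord.
Qed.

Lemma dotv_suml (R : realType) n (I : Type) (r : seq I) (P : pred I)
    (u : I -> 'rV[R]_n) v :
  dotv (\sum_(i <- r | P i) u i) v = \sum_(i <- r | P i) dotv (u i) v.
Proof.
rewrite /dotv exchange_big/=; apply: eq_bigr => j _.
by rewrite summxE mulr_suml.
Qed.

Lemma dotvZl (R : realType) n c (u v : 'rV[R]_n) : dotv (c *: u) v = c * dotv u v.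
Proof. by rewrite /dotv mulr_sumr; apply: eq_bigr => i _; rewrite mxE mulrA. Qed.

Lemma dotvC (R : realType) n (u v : 'rV[R]_n) : dotv u v = dotv v u.
Proof. by apply: eq_bigr => i _; rewrite mulrC. Qed.

Lemma dotv_delta (R : realType) n (u : 'rV[R]_n) i : dotv u (delta_mx 0 i) = u 0 i.
Proof.
rewrite /dotv (bigD1 i)//= mxE !eqxx mulr1 big1 ?addr0// => j ji.
by rewrite mxE (negbTE ji) andbF mulr0.
Qed.

Lemma dotvZr (R : realType) n c (u v : 'rV[R]_n) : dotv u (c *: v) = c * dotv u v.
Proof. by rewrite dotvC dotvZl dotvC. Qed.

(** Where [F] is differentiable, right difference quotients already converge to the directional
    derivative, so increments for small positive [t] suffice. *)
Lemma jac_dir_le (R : realType) N k (F : 'rV[R]_N -> 'rV[R]_k) z v y b :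
  differentiable F z ->
  (\forall t \near (0 : R)^'+, dotv (F (t *: v + z) - F z) y <= t * b) ->
  dotv (v *m (jac F z)^T) y <= b.
Proof.
move=> dF le; rewrite /jac trmxK -deriveEjacobian//.
have : t^-1 *: (F (t *: v + z) - F z) @[t --> (0 : R)^'+] --> 'D_v F z.
  by apply: cvg_dnbhs_at_right; exact: diff_derivable.
move=> cv; apply: (cvgr_to_le (cvg_dotv cv (cvg_cst y))); near=> t; rewrite dotvZl.
by rewrite mulrC ler_pdivrMr 1?mulrC; near: t => //; exact: nbhs_right_gt.
Unshelve. all: by end_near. Qed.

(** The conclusion describes a closed half-space of matrices: it is stable under the limits and then
    under the convex combinations that produce [M]. *)
Lemma clarke_ind (R : realType) N k (F : 'rV[R]_N -> 'rV[R]_k) (z v : 'rV[R]_N) y b M :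
  (\forall z' \near z, differentiable F z' -> dotv (v *m (jac F z')^T) y <= b) ->
  clarke F z M -> dotv (v *m M^T) y <= b.
Proof.
move=> zle [n [l [Ms [l0 [l1 [HM ->]]]]]].
have Msle i : dotv (v *m (Ms i)^T) y <= b.
  have [u [uz [ud uM]]] := HM i.
  have cvM : v *m (jac F (u j))^T @[j --> \oo] --> v *m (Ms i)^T.
    apply: (@cvg_comp _ _ _ (fun j => jac F (u j)) (fun M : 'M[R]_(k, N) => v *m M^T) \oo (nbhs (Ms i))) => //.
    exact: continuous_mul_tr.
  apply: (cvgr_to_le (cvg_dotv cvM (cvg_cst y))).
  by have [n0 _ zn0] := uz _ zle; exists n0 => // j /zn0; exact.
rewrite linear_sum mulmx_sumr dotv_suml -[b]mul1r -l1 mulr_suml ler_sum// => i _.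
by rewrite linearZ/= -scalemxAr dotvZl ler_wpM2l ?l0 ?Msle.
Qed.

Lemma clarke_dir_le (R : realType) N k (F : 'rV[R]_N -> 'rV[R]_k) (z v : 'rV[R]_N) y b M :
  (\forall z' \near z, \forall t \near (0 : R)^'+,
     dotv (F (t *: v + z') - F z') y <= t * b) ->
  clarke F z M -> dotv (v *m M^T) y <= b.
Proof.
move=> zle; apply: clarke_ind; apply: filterS zle => z' le dF; exact: jac_dir_le.
Qed.

Lemma near_right_ball (R : realType) N (z x v : 'rV[R]_N) r :
  ball z r x -> \forall t \near (0 : R)^'+, ball z r (t *: v + x).
Proof.
rewrite -ball_normE/= -subr_gt0 => zx; near=> t.
rewrite opprD addrCA addrC (le_lt_trans (ler_normB _ _))// -ltrBrDl normrZ gtr0_norm; last first.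
  by near: t; exact: nbhs_right_gt.
have v1 : 0 < 1 + `|v| by rewrite ltr_pwDl.
apply: (@le_lt_trans _ _ (t * (1 + `|v|))).
  rewrite ler_wpM2l ?lerDr//; apply: ltW; near: t; exact: nbhs_right_gt.
rewrite -ltr_pdivlMr//; near: t; apply: nbhs_right_lt; exact: divr_gt0.
Unshelve. all: by end_near. Qed.

Lemma lipschitz_dir_coord_le (R : realType) N k (F : 'rV[R]_N -> 'rV[R]_k)
    (z x : 'rV[R]_N) r L i j :
  (forall a b, ball z r a -> ball z r b -> `|F a - F b| <= L * `|a - b|) ->
  0 <= L -> ball z r x -> forall s : R, `|s| = 1 ->
  \forall t \near (0 : R)^'+,
    dotv (F (t *: delta_mx 0 j + x) - F x) (s *: delta_mx 0 i) <= t * L.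
Proof.
move=> FL L0 zx s s1.
near=> t.
have t0 : 0 < t by near: t; exact: nbhs_right_gt.
have zt : ball z r (t *: delta_mx 0 j + x) by near: t; exact: near_right_ball.
rewrite dotvZr dotv_delta (le_trans (ler_norm _))// normrM s1 mul1r.
rewrite (le_trans (mx_norm_ge_coord _ _ _))// (le_trans (FL _ _ zt zx))//.
rewrite addrK normrZ gtr0_norm// mulrC ler_wpM2r//.
rewrite ler_piMr ?(ltW t0)//; apply: mx_norm_le_coord => // a b.
by rewrite mxE; case: (_ && _); rewrite ?normr1 ?normr0.
Unshelve. all: by end_near. Qed.

Lemma mx_norm_le_dotv (R : realType) N k (M : 'M[R]_(k, N)) L : 0 <= L ->
  (forall i j (s : R), `|s| = 1 -> dotv (delta_mx 0 j *m M^T) (s *: delta_mx 0 i) <= L) ->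
  `|M| <= L.
Proof.
move=> L0 ML; apply: mx_norm_le_coord => // i j.
have Mij s : dotv (delta_mx 0 j *m M^T) (s *: delta_mx 0 i) = s * M i j.
  by rewrite dotvZr dotv_delta -rowE !mxE.
rewrite ler_norml lerNl; apply/andP; split.
  by have := ML i j (-1); rewrite normrN normr1 Mij mulN1r; apply.
by have := ML i j 1; rewrite normr1 Mij mul1r; apply.
Qed.

Lemma jac_norm_le (R : realType) N k (F : 'rV[R]_N -> 'rV[R]_k) (z x : 'rV[R]_N) r L :
  (forall a b, ball z r a -> ball z r b -> `|F a - F b| <= L * `|a - b|) ->
  0 <= L -> ball z r x -> differentiable F x -> `|jac F x| <= L.
Proof.
move=> FL L0 zx dF; apply: mx_norm_le_dotv => // i j s s1.
by apply: jac_dir_le => //; exact: lipschitz_dir_coord_le FL L0 zx s s1.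
Qed.

Lemma clarke_norm_le (R : realType) N k (F : 'rV[R]_N -> 'rV[R]_k) (z x : 'rV[R]_N) r L M :
  (forall a b, ball z r a -> ball z r b -> `|F a - F b| <= L * `|a - b|) ->
  0 <= L -> ball z r x -> clarke F x M -> `|M| <= L.
Proof.
move=> FL L0 zx cM; apply: mx_norm_le_dotv => // i j s s1.
apply: clarke_dir_le cM.
have : nbhs x (ball z r) by apply: open_nbhs_nbhs; split => //; apply: ball_open; exact: ball_gt0 zx.
by apply: filterS => x' zx'; exact: lipschitz_dir_coord_le FL L0 zx' s s1.
Qed.

(** By upper semicontinuity the bound holds up to [e] for [J] around [z]. Along short segments in
    direction [d] it becomes a bound on increments of [F], which the Jacobians near [z], and thus
    [M], inherit. *)
Lemma clarke_hull (R : realType) N k (D : set 'rV[R]_N) (F : 'rV[R]_N -> 'rV[R]_k)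
    (J : 'rV[R]_N -> set 'M[R]_(k, N)) z (d : 'rV[R]_N) (i : 'I_k) C M :
  open D -> loc_lipschitz_on D F -> conservative_on D F J -> D z ->
  (forall M', J z M' -> (d *m M'^T) 0 i <= C) ->
  clarke F z M -> (d *m M^T) 0 i <= C.
Proof.
move=> oD lF cJ Dz JC cM; apply/ler_addgt0Pr => e e0.
have [r [L [r0 L0 rD FL]]] := loc_lipschitz_ball oD lF Dz.
have : \forall z' \near z, J z' `<=` [set M' | (d *m M'^T) 0 i < C + e].
  apply: (conservative_usc oD cJ Dz).
    apply: (@open_comp _ _ (fun M' : 'M[R]_(k, N) => (d *m M'^T) 0 i) [set x | x < C + e]); last exact: open_lt.
    move=> M' _; apply: (@cvg_mx_coord _ _ (nbhs M') _ _ _ (fun M : 'M[R]_(k, N) => d *m M^T)).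
    exact: continuous_mul_tr.
  by move=> M' /JC /le_lt_trans; apply; rewrite ltrDl.
move=> /nbhs_ballP[s /= s0 sJ].
pose q := Num.min r s; have q0 : 0 < q by rewrite lt_min r0.
have qr : ball z q `<=` ball z r by apply: le_ball; rewrite ge_min lexx.
have qs : ball z q `<=` ball z s by apply: le_ball; rewrite ge_min lexx orbT.
rewrite -dotv_delta; apply: clarke_dir_le cM.
apply/nbhs_ballP; exists q => //= z' qz'.
near=> t; have t0 : 0 < t by near: t; exact: nbhs_right_gt.
have qt : ball z q (z' + t *: d) by rewrite addrC; near: t; exact: near_right_ball.
rewrite dotv_delta 2!mxE [t *: d + z']addrC.
apply: (conservative_ball_le (r := q) (L := L) cJ _ _ qz' qt).
- exact: subset_trans rD.
- by move=> x y /qr xr /qr yr; exact: FL.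
by move=> x M' /qs /sJ JM /JM /= /ltW ?; rewrite -scalemxAl mxE ler_pM2l.
Unshelve. all: by end_near. Qed.

(** Points with single-valued [J] accumulate at [z]; [F] is differentiable there with Jacobians
    bounded by the Lipschitz constant, so a subsequence of these Jacobians converges. *)
Lemma clarke_nonempty (R : realType) N k (D : set 'rV[R]_N) (F : 'rV[R]_N -> 'rV[R]_k)
    (J : 'rV[R]_N -> set 'M[R]_(k, N)) z :
  open D -> loc_lipschitz_on D F -> conservative_on D F J -> D z -> clarke F z !=set0.
Proof.
move=> oD lF cJ Dz.
have [r [L [r0 L0 rD FL]]] := loc_lipschitz_ball oD lF Dz.
have /choice[u uP] : forall j : nat, exists x,
    [/\ ball z j.+1%:R^-1 x, differentiable F x & `|jac F x| <= L].
  move=> j; pose q := Num.min r j.+1%:R^-1.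
  have q0 : 0 < q by rewrite lt_min r0 invr_gt0 ltr0n.
  have [x [M [qx Dx JM]]] := conservative_singleton_dense oD cJ Dz q0.
  have dx := conservative_singleton_differentiable oD lF cJ Dx JM.
  exists x; split => //; first by apply: le_ball qx; rewrite ge_min lexx orbT.
  by apply: jac_norm_le FL L0 _ dx; apply: le_ball qx; rewrite ge_min lexx.
have [f fk /cvg_ex[M fM]] : exists2 f : nat -> nat, (forall k, (k <= f k)%N)
    & cvgn ((fun j => jac F (u j)) \o f).
  by apply: (@bounded_cvg_subseq _ _ _ _ L) => j; have [] := uP j.
exists M, 1%N, (fun=> 1), (fun=> M); split; first by [].
split; first by rewrite big_ord1.
split; last by rewrite big_ord1 scale1r.
move=> _; exists (u \o f); split; last by split=> [j|//]; have [] := uP (f j).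
apply: cvg_subseq => //; apply/cvgrPdist_lt => e e0; near=> j.
have [+ _ _] := uP j; rewrite -ball_normE => /lt_trans; apply.
by near: j; exact: near_infty_natSinv_lt (PosNum e0).
Unshelve. all: by end_near. Qed.

(** * Caratheodory's theorem and the closed graph of the Clarke Jacobian *)

Definition conv_comb (R : realType) a b (S : set 'M[R]_(a, b)) (k : nat) (M : 'M[R]_(a, b)) :=
  exists (l : 'I_k -> R) (Ms : 'I_k -> 'M[R]_(a, b)),
     (forall i, 0 <= l i) /\ \sum_i l i = 1 /\ (forall i, S (Ms i)) /\
     M = \sum_i l i *: Ms i.

(** More than [a * b + 1] matrices are affinely dependent; moving the weights along the dependence
    until the first one vanishes removes a term. *)
Lemma conv_comb_reduce (R : realType) a b (S : set 'M[R]_(a, b)) k M :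
  (a * b < k)%N -> conv_comb S k.+1 M -> conv_comb S k M.
Proof.
move=> abk [l [Ms [l0 [l1 [SMs ->]]]]].
(* The appended column of ones turns an affine dependence into a linear one: a vector of the left
   kernel has entries summing to zero. *)
pose B : 'M[R]_(k.+1, a * b + 1) := \matrix_i row_mx (mxvec (Ms i)) 1.
have /rowV0Pn[mu /sub_kermxP muB mu0] : kermx B != 0.
  rewrite -mxrank_eq0 mxrank_ker subn_eq0 -ltnNge.
  by rewrite (leq_ltn_trans (rank_leq_col _))// addn1 ltnS.
have {}muB : \sum_i mu 0 i *: row_mx (mxvec (Ms i)) 1 = 0 :> 'rV[R]_(a * b + 1).
  rewrite -[RHS]muB mulmx_sum_row; apply: eq_bigr => i _; congr (_ *: _).
  by apply/rowP => j; rewrite !mxE.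
have mus : \sum_i mu 0 i = 0.
  have /matrixP/(_ 0 (rshift _ 0)) := muB; rewrite summxE [RHS]mxE => mu1; rewrite -[RHS]mu1.
  by apply: eq_bigr => i _; rewrite mxE row_mxEr mxE eqxx mulr1.
have muM : \sum_i mu 0 i *: Ms i = 0.
  have := congr1 (fun v => vec_mx (lsubmx v)) muB; rewrite /= !linear0 => muB0.
  rewrite -[RHS]muB0 [in RHS]linear_sum [in RHS]linear_sum/=; apply: eq_bigr => i _.
  by rewrite !linearZ/= row_mxKl mxvecK.
have [i1 mui1] : exists i, 0 < mu 0 i.
  apply: contrapT => nmu; move/eqP: mu0; apply; apply/rowP => i; rewrite mxE.
  have mule i' : 0 <= - mu 0 i'.
    by rewrite oppr_ge0 leNgt; apply/negP => ?; apply: nmu; exists i'.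
  have : \sum_i' - mu 0 i' == 0 by rewrite sumrN mus oppr0.
  rewrite psumr_eq0 => [/allP/(_ i)|i' _]; last exact: mule.
  by rewrite mem_index_enum oppr_eq0 => /(_ isT)/eqP.
(* The smallest ratio is the largest step along [- mu] that keeps all weights nonnegative, and it
   sends weight [i0] to zero. *)
pose i0 := [arg min_(i < i1 | 0 < mu 0 i) (l i / mu 0 i)]%O.
have [mui0 minl] : 0 < mu 0 i0 /\ forall j, 0 < mu 0 j -> l i0 / mu 0 i0 <= l j / mu 0 j.
  by rewrite /i0; case: arg_minP.
set t := l i0 / mu 0 i0 in minl.
have t0 : 0 <= t by rewrite divr_ge0// ltW.
pose l' i := l i - t * mu 0 i.
have l'0 i : 0 <= l' i.
  rewrite subr_ge0; have [mui|mui] := ltP 0 (mu 0 i).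
    by rewrite -ler_pdivlMr// minl.
  by rewrite (le_trans _ (l0 i))// mulr_ge0_le0.
have l'i0 : l' i0 = 0 by rewrite /l' /t divfK ?subrr// gt_eqF.
exists (fun i => l' (lift i0 i)), (fun i => Ms (lift i0 i)); split => //.
split.
  have : \sum_i l' i = 1 by rewrite sumrB -mulr_sumr mus mulr0 subr0.
  by rewrite (bigD1_ord i0)//= l'i0 add0r.
split => //; have : \sum_i l' i *: Ms i = \sum_i l i *: Ms i.
  under eq_bigr do rewrite scalerBl -scalerA.
  by rewrite sumrB -scaler_sumr muM scaler0 subr0.
by rewrite (bigD1_ord i0)//= l'i0 scale0r add0r.
Qed.

Lemma conv_comb_pad (R : realType) a b (S : set 'M[R]_(a, b)) k M :
  conv_comb S k M -> conv_comb S k.+1 M.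
Proof.
case: k => [[l [Ms [_ [+ _]]]]|k [l [Ms [l0 [l1 [SMs ->]]]]]].
  by rewrite big_ord0 => /esym/eqP; rewrite oner_eq0.
exists (fun i => if unlift ord_max i is Some j then l j else 0),
  (fun i => if unlift ord_max i is Some j then Ms j else Ms ord0).
split; first by move=> i; case: unlift.
split; first by rewrite (bigD1_ord ord_max)//= unlift_none add0r -l1; apply: eq_bigr => i _; rewrite liftK.
split; first by move=> i; case: unlift.
rewrite [RHS](bigD1_ord ord_max)//= unlift_none scale0r add0r.
by apply: eq_bigr => i _; rewrite liftK.
Qed.

(** With exactly the same number of terms for every [M], the combinations along a sequence are
    encoded by arrays of fixed size. *)
Lemma caratheodory (R : realType) a b (S : set 'M[R]_(a, b)) M :
  convmx S M -> conv_comb S (a * b).+1 M.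
Proof.
move=> [k SM]; have {SM} : conv_comb S k M by [].
have [k_le|k_gt] := leqP k (a * b).+1.
  rewrite -(subnKC k_le); elim: (_ - k)%N => [|d IH]; first by rewrite addn0.
  by move=> /IH; rewrite addnS; exact: conv_comb_pad.
rewrite -(subnKC (ltnW k_gt)); elim: (k - _)%N => [|d IH]; first by rewrite addn0.
by rewrite addnS => /conv_comb_reduce SM; apply: IH; apply: SM; rewrite ltn_addr.
Qed.

Lemma near_seq_cvg (R : realType) m n (u v : nat -> 'M[R]_(m, n)) (l : 'M[R]_(m, n)) :
  u @ \oo --> l -> (forall j, `|u j - v j| < j.+1%:R^-1) -> v @ \oo --> l.
Proof.
move=> ul uv; apply/cvgrPdist_lt => e e0.
have e2 : 0 < e / 2 by rewrite divr_gt0.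
have /cvgrPdist_lt/(_ _ e2) ul2 := ul; near=> j.
have -> : l - v j = (l - u j) + (u j - v j) by rewrite addrA subrK.
rewrite (le_lt_trans (ler_normD _ _))// [e]splitr ltrD//; first by near: j.
rewrite (lt_trans (uv j))//; near: j; exact: near_infty_natSinv_lt (PosNum e2).
Unshelve. all: by end_near. Qed.

(** The Bouligand (limiting) Jacobian; [clarke F z] unfolds to [convmx (lim_jac F z)]. *)
Definition lim_jac (R : realType) N k (F : 'rV[R]_N -> 'rV[R]_k) (z : 'rV[R]_N) : set 'M[R]_(k, N) :=
  [set M | exists u : nat -> 'rV[R]_N, u @ \oo --> z /\
     (forall j, differentiable F (u j)) /\ (fun j => jac F (u j)) @ \oo --> M].

(** Diagonal argument: for each [j], one point of differentiability is within [1/(j+1)] of [u j] and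
    its Jacobian within [1/(j+1)] of [Ms j]. *)
Lemma lim_jac_closed (R : realType) N k (F : 'rV[R]_N -> 'rV[R]_k)
    (u : nat -> 'rV[R]_N) (Ms : nat -> 'M[R]_(k, N)) (z : 'rV[R]_N) (M : 'M[R]_(k, N)) :
  u @ \oo --> z -> Ms @ \oo --> M -> (forall j, lim_jac F (u j) (Ms j)) ->
  lim_jac F z M.
Proof.
move=> uz MsM uM.
have /choice[v vP] : forall j, exists x, [/\ `|u j - x| < j.+1%:R^-1,
    differentiable F x & `|Ms j - jac F x| < j.+1%:R^-1].
  move=> j; have [w [wu [dw wM]]] := uM j.
  have j0 : 0 < j.+1%:R^-1 :> R by rewrite invr_gt0.
  have /cvgrPdist_lt/(_ _ j0)[n1 _ wn1] := wu.
  have /cvgrPdist_lt/(_ _ j0)[n2 _ wn2] := wM.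
  exists (w (maxn n1 n2)); split => //; first by apply: wn1; rewrite /= leq_maxl.
  by apply: wn2; rewrite /= leq_maxr.
exists v; split.
  by apply: near_seq_cvg uz _ => j; have [] := vP j.
split; first by move=> j; have [] := vP j.
by apply: near_seq_cvg MsM _ => j; have [] := vP j.
Qed.

Lemma cvg_vec_row (R : realType) K a b (G : nat -> 'M[R]_(K, a * b)) (Goo : 'M[R]_(K, a * b)) i :
  G @ \oo --> Goo -> (fun j => vec_mx (row i (G j)) : 'M[R]_(a, b)) @ \oo --> vec_mx (row i Goo).
Proof.
move=> /cvgrPdist_lt GG; apply/cvgrPdist_lt => e e0.
apply: filterS (GG e e0) => j /=; apply: le_lt_trans.
by apply: mx_norm_le_coord => // i' j'; rewrite !mxE (le_trans _ (mx_norm_ge_coord _ i (mxvec_index i' j')))// !mxE.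
Qed.

Lemma clarke_closed_graph (R : realType) N k (D : set 'rV[R]_N)
    (F : 'rV[R]_N -> 'rV[R]_k) (u : nat -> 'rV[R]_N) (Ms : nat -> 'M[R]_(k, N)) (z : 'rV[R]_N) (M : 'M[R]_(k, N)) :
  open D -> loc_lipschitz_on D F -> D z -> (forall j, clarke F (u j) (Ms j)) ->
  u @ \oo --> z -> Ms @ \oo --> M -> clarke F z M.
Proof.
move=> oD lF Dz cM uz MsM.
have [r [L [r0 L0 rD FL]]] := loc_lipschitz_ball oD lF Dz.
have [n0 _ un0] : \forall j \near \oo, ball z r (u j).
  by apply: uz; exact: nbhsx_ballx.
pose K := (k * N).+1.
(* The weights form one row and the vectorised matrices the rows of one matrix, so two extractions
   give convergence of the whole combination. The shift by [n0] places the points where the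
   Lipschitz constant bounds these matrices. *)
have /choice[WG WGP] : forall j, exists WG : 'rV[R]_K * 'M[R]_(K, k * N),
    [/\ forall i, 0 <= WG.1 0 i, \sum_i WG.1 0 i = 1,
      forall i, lim_jac F (u (n0 + j)%N) (vec_mx (row i WG.2)) &
      Ms (n0 + j)%N = \sum_i WG.1 0 i *: vec_mx (row i WG.2)].
  move=> j; have [l [As [l0 [l1 [SAs MsE]]]]] := caratheodory (cM (n0 + j)%N).
  exists (\row_i l i, \matrix_i mxvec (As i)) => /=; split.
  - by move=> i; rewrite mxE.
  - by rewrite -l1; apply: eq_bigr => i _; rewrite mxE.
  - by move=> i; rewrite rowK mxvecK; exact: SAs.
  - by rewrite MsE; apply: eq_bigr => i _; rewrite mxE rowK mxvecK.
have [f fk /cvg_ex[W fW]] : exists2 f : nat -> nat, (forall k, (k <= f k)%N)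
    & cvgn ((fun j => (WG j).1) \o f).
  apply: (@bounded_cvg_subseq _ _ _ _ 1) => j; have [W0 W1 _ _] := WGP j.
  apply: mx_norm_le_coord => // i0 i; rewrite (ord1 i0) ger0_norm// -W1.
  by rewrite (bigD1 i)//= lerDl sumr_ge0.
have [h hk /cvg_ex[G hG]] : exists2 h : nat -> nat, (forall k, (k <= h k)%N)
    & cvgn ((fun j => (WG (f j)).2) \o h).
  apply: (@bounded_cvg_subseq _ _ _ _ L) => j; have [_ _ S _] := WGP (f j).
  apply: mx_norm_le_coord => // i' j'.
  have <- : (mxvec (vec_mx (row i' (WG (f j)).2)) : 'rV[R]_(k * N)) 0 j' = (WG (f j)).2 i' j'.
    by rewrite vec_mxK mxE.
  case/mxvec_indexP: j' => i j''; rewrite mxvecE (le_trans (mx_norm_ge_coord _ _ _))//.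
  apply: (clarke_norm_le FL L0 (un0 (n0 + f j)%N (leq_addr _ _))).
  (* A limiting Jacobian is a one-term convex combination, so the Clarke bound [L] covers it. *)
  exists 1%N, (fun=> 1), (fun=> vec_mx (row i' (WG (f j)).2)); split => //.
  split; first by rewrite big_ord1.
  by split; [move=> _; exact: S|rewrite big_ord1 scale1r].
have {}fW : (fun j => (WG (f (h j))).1) @ \oo --> W by apply: (cvg_subseq hk fW).
have nfh j : (j <= n0 + f (h j))%N by rewrite (leq_trans (hk j))// (leq_trans (fk _))// leq_addl.
have SG i : lim_jac F z (vec_mx (row i G)).
  apply: (lim_jac_closed (u := fun j => u (n0 + f (h j))%N)
    (Ms := fun j => vec_mx (row i (WG (f (h j))).2))).
  - exact: (cvg_subseq nfh uz).
  - exact: cvg_vec_row hG.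
  - by move=> j; have [_ _ + _] := WGP (f (h j)); apply.
exists K, (W 0), (fun i => vec_mx (row i G)); split.
  move=> i; apply: (cvgr_to_ge (cvg_mx_coord (i := 0) (j := i) fW)).
  by near=> j; have [+ _ _ _] := WGP (f (h j)); apply.
split.
  have : (fun j => \sum_i (WG (f (h j))).1 0 i) @ \oo --> \sum_i W 0 i.
    by apply: cvg_big => [|i _]; [exact: add_continuous|exact: cvg_mx_coord].
  rewrite (_ : (fun j => _) = fun=> 1); last by apply/funext => j; have [] := WGP (f (h j)).
  by move=> /(cvg_unique (@Rhausdorff R)) /(_ (cvg_cst _)).
split => //.
have MM : (fun j => Ms (n0 + f (h j))%N) @ \oo --> M by exact: (cvg_subseq nfh MsM).
apply: (norm_cvg_unique MM).
rewrite (_ : (fun j => _) = fun j => \sum_i (WG (f (h j))).1 0 i *: vec_mx (row i (WG (f (h j))).2)); last first.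
  by apply/funext => j; have [] := WGP (f (h j)).
apply: cvg_big => [|i _]; first exact: add_continuous.
by apply: cvgZ; [exact: cvg_mx_coord|exact: cvg_vec_row hG].
Unshelve. all: by end_near. Qed.

Theorem clarke_conservative (R : realType) N k (D : set 'rV[R]_N)
    (F : 'rV[R]_N -> 'rV[R]_k) :
  open D -> path_diff_on D F -> conservative_on D F (clarke F).
Proof.
move=> oD [lF [J cJ]]; split; first by move=> z Dz; exact: clarke_nonempty oD lF cJ Dz.
split.
  move=> z Dz; have [r [L [r0 L0 rD FL]]] := loc_lipschitz_ball oD lF Dz.
  by exists L; apply/nbhs_ballP; exists r => //= z' rz' M; exact: clarke_norm_le FL L0 rz'.
split; first by move=> u Ms z M Dz _ cM; exact: clarke_closed_graph oD lF Dz cM.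
move=> c cA cD; have [J0 [_ [_ Jc]]] := cJ.
apply: ae_imply (Jc c cA cD) => t Ht t01.
have [dc [dF Mt]] := Ht t01; split => //; split => // M cM.
have Dc : D (c t) by apply: cD; move: t01; rewrite /= in_itv.
apply/rowP => i; apply/eqP; rewrite eq_le -[_ <= ('D_1 c t *m M^T) 0 i]lerN2; apply/andP; split; last first.
  by apply: (clarke_hull oD lF cJ Dc _ cM) => M' /Mt ->.
(* The opposite inequality is the same hull bound in the direction of the reversed velocity. *)
rewrite -[X in X <= _](_ : (- 'D_1 c t *m M^T) 0 i = _); last by rewrite mulNmx mxE.
apply: (clarke_hull oD lF cJ Dc _ cM) => M' /Mt ->.
by rewrite mulNmx mxE.
Qed.

(** * Euclidean norm and operator norm *)

Lemma dotvDl (R : realType) n (u v w : 'rV[R]_n) : dotv (u + v) w = dotv u w + dotv v w.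
Proof. by rewrite /dotv -big_split; apply: eq_bigr => i _; rewrite mxE mulrDl. Qed.

Lemma dotvDr (R : realType) n (u v w : 'rV[R]_n) : dotv w (u + v) = dotv w u + dotv w v.
Proof. by rewrite !(dotvC w) dotvDl. Qed.

Lemma dotvNl (R : realType) n (u w : 'rV[R]_n) : dotv (- u) w = - dotv u w.
Proof. by rewrite -scaleN1r dotvZl mulN1r. Qed.

Lemma dotvNr (R : realType) n (u w : 'rV[R]_n) : dotv w (- u) = - dotv w u.
Proof. by rewrite dotvC dotvNl dotvC. Qed.

Lemma dotv_ge0 (R : realType) n (u : 'rV[R]_n) : 0 <= dotv u u.
Proof. by apply: sumr_ge0 => i _; rewrite -expr2 sqr_ge0. Qed.

Lemma enorm_sqr (R : realType) n (u : 'rV[R]_n) : enorm u ^+ 2 = dotv u u.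
Proof. by rewrite sqr_sqrtr ?dotv_ge0. Qed.

Lemma enorm_ge0 (R : realType) n (u : 'rV[R]_n) : 0 <= enorm u.
Proof. exact: sqrtr_ge0. Qed.

Lemma enormN (R : realType) n (u : 'rV[R]_n) : enorm (- u) = enorm u.
Proof. by rewrite /enorm dotvNl dotvNr opprK. Qed.

Lemma enormZ (R : realType) n c (u : 'rV[R]_n) : enorm (c *: u) = `|c| * enorm u.
Proof.
by rewrite /enorm dotvZl dotvZr mulrA -expr2 sqrtrM ?sqr_ge0// sqrtr_sqr.
Qed.

Lemma mx_norm_le_enorm (R : realType) n (u : 'rV[R]_n) : `|u| <= enorm u.
Proof.
apply: mx_norm_le_coord => [|i j]; first exact: enorm_ge0.
rewrite (ord1 i) -(@ler_pXn2r _ 2)// ?nnegrE ?enorm_ge0//.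
rewrite enorm_sqr real_normK ?num_real// /dotv (bigD1 j)//= -expr2 lerDl.
by apply: sumr_ge0 => l _; rewrite -expr2 sqr_ge0.
Qed.

Lemma enorm_le_mx_norm (R : realType) n (u : 'rV[R]_n) : enorm u <= (1 + n%:R) * `|u|.
Proof.
rewrite -(@ler_pXn2r _ 2)// ?nnegrE ?enorm_ge0 ?mulr_ge0 ?addr_ge0//.
rewrite enorm_sqr exprMn.
apply: (@le_trans _ _ (\sum_(i < n) `|u| ^+ 2)).
  apply: ler_sum => i _; rewrite -expr2 -real_normK ?num_real//.
  by rewrite ler_pXn2r ?nnegrE// mx_norm_ge_coord.
rewrite sumr_const card_ord -[in leLHS]mulr_natl ler_wpM2r ?sqr_ge0//.
have : 0 <= n%:R :> R by [].
by nra.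
Qed.

Lemma enorm0_eq0 (R : realType) n (u : 'rV[R]_n) : enorm u = 0 -> u = 0.
Proof. by move=> u0; apply/normr0_eq0/eqP; rewrite eq_le normr_ge0 -u0 mx_norm_le_enorm. Qed.

Lemma dotv_le_enorm (R : realType) n (u v : 'rV[R]_n) : dotv u v <= enorm u * enorm v.
Proof.
have [u0|u0] := eqVneq (enorm u) 0.
  by rewrite u0 mul0r (enorm0_eq0 u0) -(scale0r 0) dotvZl mul0r.
have [v0|v0] := eqVneq (enorm v) 0.
  by rewrite v0 mulr0 (enorm0_eq0 v0) -(scale0r 0) dotvZr mul0r.
have ugt : 0 < enorm u by rewrite lt0r u0 enorm_ge0.
have vgt : 0 < enorm v by rewrite lt0r v0 enorm_ge0.
have := dotv_ge0 (enorm v *: u - enorm u *: v).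
rewrite dotvDl !dotvDr !dotvNl !dotvNr !dotvZl !dotvZr (dotvC v u) -!enorm_sqr.
have uv : 0 < enorm u * enorm v by rewrite mulr_gt0.
by move=> H; rewrite -(ler_pM2l uv); lra.
Qed.

(** Testing with [y = w] is enough. This is how bounds on linear functionals of Clarke matrices
    become Euclidean norm bounds. *)
Lemma enorm_le_dual (R : realType) n (w : 'rV[R]_n) b :
  0 <= b -> (forall y, dotv w y <= b * enorm y) -> enorm w <= b.
Proof.
move=> b0 wb; have := wb w; rewrite -enorm_sqr expr2.
have [->//|w0] := eqVneq (enorm w) 0.
by rewrite ler_pM2r// lt0r w0 enorm_ge0.
Qed.

Lemma enormD (R : realType) n (u v : 'rV[R]_n) : enorm (u + v) <= enorm u + enorm v.
Proof.
apply: enorm_le_dual => [|y]; first by rewrite addr_ge0 ?enorm_ge0.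
by rewrite dotvDl mulrDl lerD ?dotv_le_enorm.
Qed.

Lemma dotv_row_mx (R : realType) n m (a c : 'rV[R]_n) (b d : 'rV[R]_m) :
  dotv (row_mx a b) (row_mx c d) = dotv a c + dotv b d.
Proof.
rewrite /dotv big_split_ord/=; congr (_ + _); apply: eq_bigr => i _.
  by rewrite !row_mxEl.
by rewrite !row_mxEr.
Qed.

Lemma dotv_mul_tr (R : realType) n m (K : 'M[R]_(m, n)) x y :
  dotv (x *m K^T) y = dotv x (y *m K).
Proof.
have dotvE k (u v : 'rV[R]_k) : dotv u v = (u *m v^T) 0 0.
  by rewrite mxE; apply: eq_bigr => i _; rewrite mxE.
by rewrite !dotvE trmx_mul mulmxA.
Qed.

Lemma enorm_opnorm (R : realType) n m (K : 'M[R]_(m, n)) x :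
  enorm (x *m K^T) <= opnorm K * enorm x.
Proof.
have [x0|x0] := eqVneq (enorm x) 0.
  by rewrite x0 mulr0 (enorm0_eq0 x0) mul0mx -(scale0r 0) enormZ normr0 mul0r.
have xgt : 0 < enorm x by rewrite lt0r x0 enorm_ge0.
rewrite -ler_pdivrMr// mulrC -[X in X * _]ger0_norm ?invr_ge0 ?enorm_ge0// -enormZ scalemxAl.
apply: ub_le_sup; last first.
  exists ((enorm x)^-1 *: x) => //=.
  by rewrite enormZ ger0_norm ?invr_ge0 ?enorm_ge0// mulVf.
exists ((1 + m%:R) * (n%:R * `|K|)) => _ [u /= u1 <-].
rewrite (le_trans (enorm_le_mx_norm _))// ler_wpM2l ?addr_ge0//.
apply: mx_norm_le_coord => [|i j]; first by rewrite mulr_ge0.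
rewrite (ord1 i) (le_trans (mulmx_tr_coord_le _ _ _))// ler_wpM2r//.
by rewrite ler_piMr// (le_trans (mx_norm_le_enorm _)).
Qed.

Lemma enorm_mul_le (R : realType) n m (K : 'M[R]_(m, n)) b y :
  opnorm K <= b -> 0 <= b -> enorm (y *m K) <= b * enorm y.
Proof.
move=> Kb b0; apply: enorm_le_dual => [|x]; first by rewrite mulr_ge0 ?enorm_ge0.
rewrite dotvC -dotv_mul_tr (le_trans (dotv_le_enorm _ _))// mulrAC ler_wpM2r ?enorm_ge0//.
by rewrite (le_trans (enorm_opnorm _ _))// ler_wpM2r ?enorm_ge0.
Qed.

(** * Proximal maps: existence, variational inequality, Lipschitz constant *)

Lemma closed_fun_cvg (R : realType) n (g : 'rV[R]_n -> \bar R)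
    (u : nat -> 'rV[R]_n) (c : nat -> R) x r :
  closed_fun g -> u @ \oo --> x -> c @ \oo --> r ->
  (forall k, (g (u k) <= (c k)%:E)%E) -> (g x <= r%:E)%E.
Proof.
move=> cg ux cr guc.
have H : (u k, c k) @[k --> \oo] --> (x, r) :=
  @cvg_pair _ _ _ _ _ _ eventually_filter (nbhs_filter x) (nbhs_filter r) _ _ ux cr.
refine (@closed_cvg _ _ _ _ _ (fun q : 'rV[R]_n * R => (g q.1 <= q.2%:E)%E) cg _ (x, r) H).
by exists 0%N => // k _; exact: guc.
Qed.

(** At a limit of a subsequence the closed epigraph would force [g x] below every real, against
    properness. *)
Lemma closed_fun_unbounded (R : realType) n (g : 'rV[R]_n -> \bar R)
    (u : nat -> 'rV[R]_n) b :
  closed_fun g -> proper_fun g -> (forall k, `|u k| <= b) ->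
  ~ (forall k, (g (u k) <= (- k%:R)%:E)%E).
Proof.
move=> cg [gNy _] ub gu.
have [f fk /cvg_ex[x fx]] := bounded_cvg_subseq ub.
suff gx r : (g x <= r%:E)%E.
  by move: (gNy x); case: (g x) gx => [s /(_ (s - 1))|/(_ 0)|//]; rewrite ?lee_fin ?leye_eq//; lra.
have [k0 rk] : exists k0 : nat, - r <= k0%:R.
  by exists (Num.truncn `|r|).+1; rewrite (le_trans _ (ltW (truncnS_gt _)))// -normrN ler_norm.
apply: (@closed_fun_cvg _ _ _ (fun k => u (f (k0 + k)%N)) (fun=> r) x r cg).
- by apply: (@cvg_subseq _ (u \o f) (addn k0)) => // k; exact: leq_addl.
- exact: cvg_cst.
- move=> k; apply: le_trans (gu _) _; rewrite lee_fin lerNl (le_trans rk)// ler_nat.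
  by rewrite (leq_trans (leq_addr k k0)).
Qed.

Lemma closed_fun_bounded_below (R : realType) n (g : 'rV[R]_n -> \bar R) x0 b :
  closed_fun g -> proper_fun g ->
  exists m : R, forall u, `|u - x0| <= b -> (m%:E <= g u)%E.
Proof.
move=> cg pg; apply: contrapT => nm.
have /choice[u uP] : forall k : nat, exists u, `|u - x0| <= b /\ (g u <= (- k%:R)%:E)%E.
  move=> k; apply: contrapT => nu; apply: nm; exists (- k%:R) => u ub.
  by rewrite leNgt; apply/negP => gu; apply: nu; exists u; split=> //; exact: ltW.
apply: (@closed_fun_unbounded _ _ g u (b + `|x0|) cg pg) => k; last by have [] := uP k.
have [ub _] := uP k.
by rewrite -(subrK x0 (u k)) (le_trans (ler_normD _ _))// lerD2r.
Qed.

(** The point at distance 1 from [x0] towards [u] has value at least [m]; by convexity [g u]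
    decreases at most linearly in the distance [s] from [x0], and the quadratic term wins. *)
Lemma prox_coercive (R : realType) n (g : 'rV[R]_n -> \bar R) a x x0 (H : R) :
  closed_fun g -> proper_fun g -> 0 <= a -> strongly_convex a g -> g x0 \is a fin_num ->
  exists S : R, forall u, (g u + (enorm (x - u) ^+ 2 / 2)%:E <= H%:E)%E -> `|u - x0| <= S.
Proof.
move=> cg pg a0 sg gx0.
have [m gm] := closed_fun_bounded_below x0 1 cg pg.
pose C : R := `|m| + `|fine (g x0)|; pose b : R := `|x - x0|.
have C0 : 0 <= C by rewrite addr_ge0.
(* With [q = s - b > Q >= 1], the product [Q * q] exceeds [2 * (C * (q + b) + H)], so the quadratic
   term [q ^+ 2 / 2] is more than [C * s + H]. *)
pose Q : R := 1 + 2 * C + 2 * `|H| + 2 * C * b.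
have b0 : 0 <= b by exact: normr_ge0.
have Q1 : 1 <= Q.
  have := normr_ge0 H; have : 0 <= C * b by rewrite mulr_ge0.
  rewrite /Q; lra.
exists (b + Q) => u hu; rewrite leNgt; apply/negP => bQ.
set s := `|u - x0| in bQ.
have s1 : 1 < s by lra.
have s0 : 0 < s by lra.
have gNy := pg.1 u.
have [r gur] : exists r, g u = r%:E.
  move: hu gNy; case: (g u) => [r _ _|//|//]; by exists r.
have [r0 gx0r] : exists r, g x0 = r%:E by exists (fine (g x0)); rewrite fineK.
have t01 : 0 < s^-1 < 1 by rewrite invr_gt0 s0 invf_lt1.
have := sg u x0 s^-1 t01; rewrite gur gx0r -!EFinM -!EFinD => gle.
have : (m%:E <= g (s^-1 *: u + (1 - s^-1) *: x0)%R)%E.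
  apply: gm; rewrite (_ : _ - _ = s^-1 *: (u - x0)); last first.
    by apply/matrixP => i j; rewrite !mxE; ring.
  by rewrite normrZ gtr0_norm ?invr_gt0// mulVf// gt_eqF.
move=> /le_trans/(_ gle); rewrite lee_fin => {}gle.
have {}gle : m <= s^-1 * r + (1 - s^-1) * r0.
  apply: le_trans gle _; rewrite lerBlDr lerDl.
  case/andP: t01 => t0 t1.
  by rewrite !mulr_ge0 ?subr_ge0 ?enorm_ge0 ?(ltW t0) ?(ltW t1).
have rle : - C * s <= r.
  have : s * m <= s * (s^-1 * r + (1 - s^-1) * r0) by rewrite ler_pM2l.
  rewrite mulrDr mulrA mulfV ?gt_eqF// mul1r mulrA mulrBr mulr1 mulfV ?gt_eqF//.
  have m1 : - (`|m| * s) <= s * m.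
    by rewrite mulrC -mulrN ler_pM2l// lerNl -normrN ler_norm.
  have m2 : (s - 1) * r0 <= `|r0| * s.
    apply: (@le_trans _ _ ((s - 1) * `|r0|)).
      by rewrite ler_wpM2l ?ler_norm//; lra.
    by have := normr_ge0 r0; nra.
  rewrite /C gx0r/=; lra.
have qs : s - b <= enorm (x - u).
  apply: le_trans (mx_norm_le_enorm _); rewrite /s /b lerBlDr.
  have -> : u - x0 = (x - x0) - (x - u) by apply/matrixP => i j; rewrite !mxE; ring.
  by rewrite [leRHS]addrC ler_normB.
move: hu; rewrite gur -EFinD lee_fin => hu.
have sqle : (s - b) ^+ 2 <= enorm (x - u) ^+ 2.
  by rewrite ler_pXn2r// nnegrE ?enorm_ge0//; lra.
have := ler_norm H.
have qQ : Q < s - b by lra.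
have : Q * (s - b) <= (s - b) ^+ 2 by rewrite expr2 ler_wpM2r// ?ltW//; lra.
have nH := normr_ge0 H.
have p1 : 2 * `|H| * 1 <= 2 * `|H| * (s - b) by rewrite ler_wpM2l//; lra.
have p2 : 2 * C * b * 1 <= 2 * C * b * (s - b).
  by rewrite ler_wpM2l ?mulr_ge0//; lra.
move: rle sqle; rewrite /Q; lra.
Qed.

(** The direct method: coercivity bounds a minimising sequence, and the closed epigraph passes the
    infimum to a limit point. *)
Lemma prox_exists (R : realType) n (g : 'rV[R]_n -> \bar R) a x :
  closed_fun g -> proper_fun g -> 0 <= a -> strongly_convex a g ->
  exists u, is_prox g x u.
Proof.
move=> cg pg a0 sg; have [gNy [x0 gx0]] := pg.
pose h u := (g u + (enorm (x - u) ^+ 2 / 2)%:E)%E.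
pose V := [set r : R | exists u, h u = r%:E].
have hNy u : h u != -oo%E by rewrite /h; move: (gNy u); case: (g u).
have V0 : V !=set0.
  by exists (fine (h x0)), x0; rewrite fineK// /h fin_numD gx0.
have Vlb : has_lbound V.
  have [S hS] := prox_coercive x 0 cg pg a0 sg gx0.
  have [m gm] := closed_fun_bounded_below x0 S cg pg.
  (* Only values at most 0 need a bound; coercivity at level 0 confines their arguments to a ball on
     which [g] is at least [m]. *)
  exists (Num.min m 0) => r [u hur].
  have [r0|r0] := leP 0 r; first by rewrite ge_min r0 orbT.
  have /gm gu : `|u - x0| <= S by apply: hS; rewrite -/(h u) hur lee_fin ltW.
  rewrite ge_min; apply/orP; left; rewrite -lee_fin -hur.
  by apply: (le_trans gu); rewrite /h leeDl// lee_fin divr_ge0// sqr_ge0.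
have hiV : has_inf V by split.
have /choice[u uP] : forall k : nat, exists u, (h u <= (inf V + k.+1%:R^-1)%:E)%E.
  move=> k; have k0 : 0 < k.+1%:R^-1 :> R by rewrite invr_gt0.
  have [r [u hur] rlt] := inf_adherent k0 hiV.
  by exists u; rewrite hur lee_fin ltW.
have [S hS] := prox_coercive x (inf V + 1) cg pg a0 sg gx0.
have uS k : `|u k| <= S + `|x0|.
  rewrite -(subrK x0 (u k)) (le_trans (ler_normD _ _))// lerD2r; apply: hS.
  by apply: (le_trans (uP k)); rewrite lee_fin lerD2l invf_le1// ler1n.
have [f fk /cvg_ex[l fl]] := bounded_cvg_subseq uS.
exists l => w.
have gl : (g l <= (inf V - enorm (x - l) ^+ 2 / 2)%:E)%E.
  apply: (@closed_fun_cvg _ _ _ (u \o f)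
    (fun k => inf V + (f k).+1%:R^-1 - enorm (x - u (f k)) ^+ 2 / 2) _ _ cg fl).
    apply: cvgB.
      rewrite -[X in _ --> X]addr0; apply: cvgD; first exact: cvg_cst.
      exact: (@cvg_subseq R harmonic f 0 fk cvg_harmonic).
    apply: cvgMl; rewrite enorm_sqr.
    under eq_fun do rewrite enorm_sqr.
    have xl : (fun k => x - u (f k)) @ \oo --> x - l by apply: cvgB => //; exact: cvg_cst.
    exact: cvg_dotv.
  move=> k; have := uP (f k); rewrite /h /=.
  by move: (gNy (u (f k))); case: (g (u (f k))) => [r|//|//] _; rewrite -EFinD !lee_fin lerBrDr.
apply: (@le_trans _ _ (inf V)%:E).
  move: gl; move: (gNy l); case: (g l) => [r|//|//] _.
  by rewrite -EFinD !lee_fin lerBrDr.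
rewrite -/(h w); move: (hNy w); case hw : (h w) => [r| |//] _; last exact: leey.
by rewrite lee_fin; apply: ge_inf => //; exists w.
Qed.

Lemma proper_scale (R : realType) n c (g : 'rV[R]_n -> \bar R) :
  0 < c -> proper_fun g -> proper_fun (fun u => c%:E * g u)%E.
Proof.
move=> c0 [gNy [x0 gx0]]; split; last by exists x0; rewrite fin_numM.
by move=> x; move: (gNy x); case: (g x) => [r _||//]; rewrite ?gt0_muley// lte_fin.
Qed.

Lemma closed_scale (R : realType) n c (g : 'rV[R]_n -> \bar R) :
  0 < c -> closed_fun g -> closed_fun (fun u => c%:E * g u)%E.
Proof.
move=> c0 cg; rewrite /closed_fun.
rewrite (_ : mkset _ = (fun q : 'rV[R]_n * R => (q.1, c^-1 * q.2)) @^-1`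
    [set q | (g q.1 <= q.2%:E)%E]); last first.
  apply/seteqP; split => -[u r] /=; case: (g u) => [s| |];
    rewrite ?gt0_muley ?gt0_muleNy ?lte_fin ?leNye ?leye_eq// -?EFinM ?lee_fin.
    by rewrite ler_pdivlMl.
  by rewrite ler_pdivlMl.
apply: closed_comp => // q _.
apply: (@cvg_pair _ _ _ _ _ _ (nbhs_filter q) (nbhs_filter q.1) (nbhs_filter (c^-1 * q.2))).
  exact: cvg_fst.
by apply: cvgMr; exact: cvg_snd.
Qed.

Lemma strongly_convex_scale (R : realType) n c a (g : 'rV[R]_n -> \bar R) :
  0 < c -> proper_fun g -> strongly_convex a g ->
  strongly_convex (c * a) (fun u => c%:E * g u)%E.
Proof.
move=> c0 [gNy _] sg x y t /[dup] t01 /andP[t0 t1].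
have t1' : 0 < 1 - t by rewrite subr_gt0.
have := sg x y t t01; move: (gNy x) (gNy y).
move: (gNy (t *: x + (1 - t) *: y)).
case: (g x) => [gx| |//] gz _; case: (g y) => [gy| |//] _.
- move: gz; case: (g _) => [gz| |//] _ //.
  rewrite -!EFinM -!EFinD !lee_fin => H.
  have : c * gz <= c * (t * gx + (1 - t) * gy - a / 2 * t * (1 - t) * enorm (x - y) ^+ 2).
    by rewrite ler_pM2l.
  by lra.
- by move=> _; rewrite !gt0_muley ?lte_fin// leey.
- by move=> _; rewrite !gt0_muley ?lte_fin// leey.
- by move=> _; rewrite !gt0_muley ?lte_fin// leey.
Qed.

Lemma enormB_sqr (R : realType) n (u v : 'rV[R]_n) :
  enorm (u - v) ^+ 2 = enorm u ^+ 2 - 2 * dotv u v + enorm v ^+ 2.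
Proof. by rewrite !enorm_sqr dotvDl !dotvDr !dotvNl !dotvNr (dotvC v u); ring. Qed.

Lemma variational_is_prox (R : realType) n (g : 'rV[R]_n -> \bar R) x u :
  g u \is a fin_num ->
  (forall w, g u + (dotv (x - u) (w - u))%:E <= g w)%E -> is_prox g x u.
Proof.
move=> gu H w; have := H w.
have -> : enorm (x - w) ^+ 2 = enorm (x - u) ^+ 2 - 2 * dotv (x - u) (w - u) + enorm (w - u) ^+ 2.
  by rewrite -enormB_sqr opprB addrA subrK.
have := sqr_ge0 (enorm (w - u)).
move: gu; case: (g u) => [r _| |]//; case: (g w) => [s| |]//=.
  by rewrite -!EFinD !lee_fin; lra.
by move=> _ _; rewrite addye// leey.
Qed.

(** Compare [u] with the point [t w + (1 - t) u], divide by [t] and let [t] tend to 0; the strong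
    convexity term survives the limit. *)
Lemma is_prox_variational (R : realType) n (g : 'rV[R]_n -> \bar R) a x u :
  proper_fun g -> strongly_convex a g -> is_prox g x u ->
  g u \is a fin_num /\
  forall w, (g u + (dotv (x - u) (w - u) + a / 2 * enorm (w - u) ^+ 2)%:E <= g w)%E.
Proof.
move=> [gNy [x0 gx0]] sg Hu.
have gu : g u \is a fin_num.
  have := Hu x0; move: (gNy u) gx0; case: (g u) => [//| |//] _; case: (g x0) => //.
split => // w; case gw : (g w) => [r| |]; [|exact: leey|by have := gNy w; rewrite gw].
have [s gus] : exists s, g u = s%:E by exists (fine (g u)); rewrite fineK.
rewrite gus -EFinD lee_fin.
set d := dotv _ _; set D := enorm (w - u) ^+ 2.
have D0 : 0 <= D by exact: sqr_ge0.
suff key t : 0 < t -> t < 1 -> s + d + a / 2 * D - t * (a / 2 * D + D / 2) <= r.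
  apply/ler_addgt0Pr => e e0; pose E := `|a / 2 * D + D / 2|.
  have E1 : 0 < 1 + E by rewrite /E ltr_pwDl.
  pose t := Num.min (1 / 2) (e / (1 + E)).
  have t0 : 0 < t by rewrite lt_min !divr_gt0.
  have t1 : t < 1 by rewrite (@le_lt_trans _ _ (1 / 2)) ?ge_min ?lexx//; lra.
  have te : t * (a / 2 * D + D / 2) <= e.
    apply: (@le_trans _ _ (t * (1 + E))).
      by rewrite ler_pM2l// (le_trans (ler_norm _))// lerDr.
    by rewrite -ler_pdivlMr// ge_min lexx orbT.
  have := key t t0 t1; lra.
move=> t0 t1; have t01 : 0 < t < 1 by rewrite t0.
pose z := t *: w + (1 - t) *: u.
have := Hu z; have := sg w u t t01; rewrite -/z gw gus -!EFinM -!EFinD.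
have -> : enorm (x - z) ^+ 2 = enorm (x - u) ^+ 2 - 2 * (t * d) + t ^+ 2 * D.
  have -> : x - z = (x - u) - t *: (w - u) by apply/matrixP => i j; rewrite !mxE; ring.
  by rewrite [LHS]enormB_sqr dotvZr enormZ exprMn real_normK ?num_real.
case: (g z) (gNy z) => [h| |//] _ //; rewrite -!EFinD !lee_fin -/D => H1 H2.
have : t * (s + d + a / 2 * D - t * (a / 2 * D + D / 2)) <= t * r.
  by move: H1 H2; rewrite expr2; lra.
by rewrite ler_pM2l.
Qed.

Lemma prox_spec (R : realType) n (g : 'rV[R]_n -> \bar R) a x :
  closed_fun g -> proper_fun g -> 0 <= a -> strongly_convex a g ->
  is_prox g x (prox g x).
Proof.
move=> cg pg a0 sg; have [u ux] := prox_exists x cg pg a0 sg.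
exact: (@xgetPex _ 0 [set u | is_prox g x u] (ex_intro _ u ux)).
Qed.

(** Add the two variational inequalities, each tested at the other prox point: the function values
    cancel and each contributes [a / 2]. *)
Lemma is_prox_monotone (R : realType) n (g : 'rV[R]_n -> \bar R) a x x' u u' :
  proper_fun g -> strongly_convex a g -> is_prox g x u -> is_prox g x' u' ->
  (1 + a) * enorm (u - u') ^+ 2 <= dotv (x - x') (u - u').
Proof.
move=> pg sg /(is_prox_variational pg sg)[gu /(_ u')] + /(is_prox_variational pg sg)[gu' /(_ u)].
rewrite -(fineK gu) -(fineK gu') -!EFinD !lee_fin.
have -> : u' - u = - (u - u') by rewrite opprB.
have -> : x - x' = (x - u) - (x' - u') + (u - u').
  by apply/matrixP => i j; rewrite !mxE; ring.
move: (x - u) (x' - u') (u - u') => A B d.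
rewrite enormN dotvNr !dotvDl dotvNl -(enorm_sqr d); lra.
Qed.

Lemma prox_lipschitz (R : realType) n (g : 'rV[R]_n -> \bar R) a x x' :
  closed_fun g -> proper_fun g -> 0 <= a -> strongly_convex a g ->
  (1 + a) * enorm (prox g x - prox g x') <= enorm (x - x').
Proof.
move=> cg pg a0 sg; have := is_prox_monotone pg sg (prox_spec x cg pg a0 sg) (prox_spec x' cg pg a0 sg).
set d := prox g x - prox g x'; move=> H; have := le_trans H (dotv_le_enorm _ _).
have [->|d0] := eqVneq (enorm d) 0; first by rewrite !mulr0 enorm_ge0.
by rewrite expr2 mulrA ler_pM2r// lt0r d0 enorm_ge0.
Qed.

Lemma prox_subdiff (R : realType) n (g : 'rV[R]_n -> \bar R) a c x u :
  closed_fun g -> proper_fun g -> 0 <= a -> strongly_convex a g -> 0 < c ->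
  prox (fun u => c%:E * g u)%E x = u <-> subdiff g u (c^-1 *: (x - u)).
Proof.
move=> cg pg a0 sg c0.
have ccg := closed_scale c0 cg; have pcg := proper_scale c0 pg.
have scg := strongly_convex_scale c0 pg sg.
have ca0 : 0 <= c * a by rewrite mulr_ge0// ltW.
have fin_scale w : ((c%:E * g w)%E \is a fin_num) = (g w \is a fin_num).
  by case: (g w) => [r| |]//; rewrite ?gt0_muley ?gt0_muleNy ?lte_fin.
split.
- move=> <-; set v := prox _ _.
  have [gv H] := is_prox_variational pcg scg (prox_spec x ccg pcg ca0 scg).
  rewrite -/v in gv H; rewrite fin_scale in gv; split => // w.
  have := H w; rewrite -(fineK gv) dotvZl.
  move: (pg.1 w); case: (g w) => [r| |//] _; last by rewrite leey.
  rewrite -!EFinM -!EFinD !lee_fin => {}H; rewrite -(ler_pM2l c0) mulrDr.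
  rewrite mulrA mulfV ?gt_eqF// mul1r (le_trans _ H)// addrA lerDl.
  by rewrite mulr_ge0 ?divr_ge0 ?sqr_ge0.
- move=> [gu H]; have ux : is_prox (fun u => c%:E * g u)%E x u.
    apply: variational_is_prox; first by rewrite fin_scale.
    move=> w; have := H w; rewrite -(fineK gu) dotvZl.
    move: (pg.1 w); case: (g w) => [r| |//] _; last by move=> _; rewrite gt0_muley ?lte_fin// leey.
    rewrite -!EFinM -!EFinD !lee_fin => H1.
    have : c * (fine (g u) + c^-1 * dotv (x - u) (w - u)) <= c * r by rewrite ler_pM2l.
    by rewrite mulrDr mulrA mulfV ?gt_eqF// mul1r.
  (* [prox] is selected by choice, so identifying it with [u] takes uniqueness: monotonicity for two
     prox points of the same [x]. *)
  have := is_prox_monotone pcg scg (prox_spec x ccg pcg ca0 scg) ux.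
  rewrite subrr -(scale0r 0) dotvZl mul0r => H0.
  have : enorm (prox (fun u => c%:E * g u)%E x - u) ^+ 2 <= 0.
    have ca1 : 0 < 1 + c * a by rewrite ltr_pwDl.
    by rewrite -(ler_pM2l ca1) mulr0.
  move=> H1; apply/eqP; rewrite -subr_eq0; apply/eqP/enorm0_eq0/eqP.
  by rewrite -sqrf_eq0 eq_le H1 sqr_ge0.
Qed.

(** * Saddle points and fixed points of Euclidean contractions *)

(** With one variable frozen the coupling is linear in the other, so each half of the saddle
    property is a subgradient inequality. *)
Lemma saddle_subdiff (R : realType) m n (g : 'rV[R]_n -> \bar R)
    (fs : 'rV[R]_m -> \bar R) (K : 'M[R]_(m, n)) x y :
  proper_fun g -> proper_fun fs ->
  is_saddle g fs K x y <->
  (subdiff fs y (x *m K^T) /\ subdiff g x (- (y *m K))).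
Proof.
move=> [gNy _] [fNy _].
have dx x' : dotv (- (y *m K)) (x' - x) = dotv (x *m K^T) y - dotv (x' *m K^T) y.
  by rewrite dotvNl dotvDr dotvNr !dotv_mul_tr !(dotvC _ (y *m K)); ring.
have dy y' : dotv (x *m K^T) (y' - y) = dotv (x *m K^T) y' - dotv (x *m K^T) y.
  by rewrite dotvDr dotvNr.
rewrite /is_saddle /lagr /subdiff /=; split.
- move=> [gx [fy H]]; rewrite -(fineK gx) -(fineK fy) in H *; split; split => // w.
    have [+ _] := H x w; rewrite dy; move: (fNy w); case: (fs w) => [r| |//] _; last by move=> _; exact: leey.
    by rewrite -!EFinD !lee_fin; lra.
  have [_] := H w y; rewrite dx; move: (gNy w); case: (g w) => [r| |//] _; last by move=> _; exact: leey.
  by rewrite -!EFinD !lee_fin; lra.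
- move=> [[fy Hf] [gx Hg]]; split => //; split => // x' y'.
  rewrite -(fineK gx) -(fineK fy) in Hf Hg *; split.
    have := Hf y'; rewrite dy; move: (fNy y'); case: (fs y') => [r| |//] _; last by move=> _; rewrite addeNy leNye.
    by rewrite -!EFinD !lee_fin; lra.
  have := Hg x'; rewrite dx; move: (gNy x'); case: (g x') => [r| |//] _; last by move=> _; exact: leey.
  by rewrite -!EFinD !lee_fin; lra.
Qed.

(** The iterates stay in a ball of radius [c / (1 - q)], so a subsequence converges; consecutive
    iterates get close geometrically, which makes its limit fixed. *)
Lemma enorm_contraction_fixed (R : realType) n (G : 'rV[R]_n -> 'rV[R]_n) q :
  0 <= q -> q < 1 -> (forall a b, enorm (G a - G b) <= q * enorm (a - b)) ->
  exists z, G z = z.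
Proof.
move=> q0 q1 Gq.
have q1' : 0 < 1 - q by rewrite subr_gt0.
pose c := enorm (G 0); pose z k := iter k G 0.
have c0 : 0 <= c by exact: enorm_ge0.
have zb k : `|z k| <= c / (1 - q).
  apply: le_trans (mx_norm_le_enorm _) _; elim: k => [|k IH].
    by rewrite /z /= -(scale0r 0) enormZ normr0 mul0r divr_ge0// ltW.
  have -> : z k.+1 = (G (z k) - G 0) + G 0 by rewrite subrK.
  rewrite (le_trans (enormD _ _))//.
  apply: (@le_trans _ _ (q * (c / (1 - q)) + c)).
    by rewrite lerD2r (le_trans (Gq _ _))// subr0 ler_wpM2l.
  have cE : c = (1 - q) * (c / (1 - q)) by rewrite mulrC divfK// gt_eqF.
  by rewrite [X in _ + X]cE; lra.
have zq k : enorm (z k.+1 - z k) <= q ^+ k * c.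
  elim: k => [|k IH]; first by rewrite expr0 mul1r /z /= subr0.
  by rewrite (le_trans (Gq _ _))// exprS -mulrA ler_wpM2l.
have [f fk /cvg_ex[l fl]] := bounded_cvg_subseq zb.
exists l; apply/eqP; rewrite -subr_eq0; apply/eqP/enorm0_eq0/eqP.
rewrite eq_le enorm_ge0 andbT; apply/ler_addgt0Pl => e e0; rewrite addr0.
(* The distance from [l] to an iterate enters twice, once multiplied by [q]; [1 + n] converts sup
   norm to Euclidean norm. *)
pose C := (1 + q) * (1 + n%:R).
have C0 : 0 < C by rewrite mulr_gt0// ltr_pwDl.
have eC : 0 < e / 2 / C by rewrite !divr_gt0.
have e2 : 0 < e / 2 by rewrite divr_gt0.
have qc : (fun k => c * q ^+ (f k)) @ \oo --> (0 : R).
  apply: (@cvg_subseq R (geometric c q) f) => //.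
  by apply: cvg_geometric; rewrite ger0_norm.
near \oo => k.
have lk : `|l - z (f k)| <= e / 2 / C.
  by near: k; move/cvgrPdist_le : fl; apply.
have qk : c * q ^+ f k <= e / 2.
  have : `|0 - c * q ^+ f k| <= e / 2 by near: k; move/cvgrPdist_le : qc; apply.
  by rewrite sub0r normrN; apply: le_trans; exact: ler_norm.
have -> : G l - l = (G l - G (z (f k))) + (z (f k).+1 - z (f k)) + (z (f k) - l).
  by rewrite /z /=; apply/matrixP => i j; rewrite !mxE; ring.
have el : enorm (l - z (f k)) <= (1 + n%:R) * (e / 2 / C).
  by rewrite (le_trans (enorm_le_mx_norm _))// ler_wpM2l// addr_ge0.
have eC2 : (1 + q) * ((1 + n%:R) * (e / 2 / C)) = e / 2.
  have n1 : 1 + n%:R != 0 :> R by rewrite gt_eqF// ltr_pwDl.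
  have q1n : 1 + q != 0 by rewrite gt_eqF// ltr_pwDl.
  by rewrite /C; field; rewrite n1 q1n.
have := enormD (G l - G (z (f k)) + (z (f k).+1 - z (f k))) (z (f k) - l).
have := enormD (G l - G (z (f k))) (z (f k).+1 - z (f k)).
have := Gq l (z (f k)); have := zq (f k).
have -> : enorm (z (f k) - l) = enorm (l - z (f k)) by rewrite -enormN opprB.
have : (1 + q) * enorm (l - z (f k)) <= e / 2 by rewrite -eC2 ler_wpM2l// addr_ge0.
lra.
Unshelve. all: by end_near. Qed.

(** * Calculus of locally Lipschitz maps and absolutely continuous curves *)

Lemma mx_norm_row_mx (R : realType) n m (a : 'rV[R]_n) (b : 'rV[R]_m) :
  `|row_mx a b| <= `|a| + `|b|.
Proof.
apply: mx_norm_le_coord => [|i j]; first exact: addr_ge0.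
rewrite -(splitK j); case: (fintype.split j) => k /=.
  by rewrite row_mxEl (le_trans (mx_norm_ge_coord _ _ _))// lerDl.
by rewrite row_mxEr (le_trans (mx_norm_ge_coord _ _ _))// lerDr.
Qed.

Lemma mx_norm_lsubmx (R : realType) k n m (a : 'M[R]_(k, n + m)) : `|lsubmx a| <= `|a|.
Proof. by apply: mx_norm_le_coord => // i j; rewrite mxE mx_norm_ge_coord. Qed.

Lemma mx_norm_rsubmx (R : realType) k n m (a : 'M[R]_(k, n + m)) : `|rsubmx a| <= `|a|.
Proof. by apply: mx_norm_le_coord => // i j; rewrite mxE mx_norm_ge_coord. Qed.

Lemma loc_lipschitz_shrink (R : realType) N k (D : set 'rV[R]_N) (F : 'rV[R]_N -> 'rV[R]_k) z :
  loc_lipschitz_on D F -> D z -> exists r L, [/\ 0 < r, 0 <= L &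
    forall s, s <= r -> forall a b, ball z s a -> ball z s b -> `|F a - F b| <= L * `|a - b|].
Proof.
move=> lF Dz; have [r [L [r0 FL]]] := lF z Dz.
exists r, `|L|; split => // s sr a b za zb.
apply: le_trans (FL _ _ (le_ball sr za) (le_ball sr zb)) _.
by rewrite ler_wpM2r// ler_norm.
Qed.

Lemma loc_lipschitz_comp (R : realType) N k l (D : set 'rV[R]_N) (E : set 'rV[R]_k)
    (F : 'rV[R]_N -> 'rV[R]_k) (G : 'rV[R]_k -> 'rV[R]_l) :
  loc_lipschitz_on D F -> loc_lipschitz_on E G -> (forall z, D z -> E (F z)) ->
  loc_lipschitz_on D (fun z => G (F z)).
Proof.
move=> lF lG DE z Dz.
have [r [L [r0 L0 FL]]] := loc_lipschitz_shrink lF Dz.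
have [s [M [s0 M0 GM]]] := loc_lipschitz_shrink lG (DE _ Dz).
have L1 : 0 < 1 + L by rewrite ltr_pwDl.
pose q := Num.min r (s / (1 + L)).
have q0 : 0 < q by rewrite lt_min r0 divr_gt0.
have qr : q <= r by rewrite ge_min lexx.
have Fs a : ball z q a -> ball (F z) s (F a).
  move=> qa; rewrite -ball_normE/=.
  apply: (le_lt_trans (FL _ qr _ _ (ballxx _ q0) qa)).
  move: qa; rewrite -ball_normE/= lt_min ltr_pdivlMr// => /andP[_]; apply: le_lt_trans.
  by rewrite mulrC ler_wpM2l// lerDr.
exists q, (M * L); split => // a b qa qb.
apply: (le_trans (GM _ (lexx _) _ _ (Fs _ qa) (Fs _ qb))).
by rewrite -mulrA ler_wpM2l// (FL _ qr).
Qed.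

Lemma loc_lipschitz_lip1 (R : realType) N k (D : set 'rV[R]_N) (F : 'rV[R]_N -> 'rV[R]_k) :
  (forall a b, `|F a - F b| <= `|a - b|) -> loc_lipschitz_on D F.
Proof. by move=> F1 z _; exists 1, 1; split => // a b _ _; rewrite mul1r. Qed.

Lemma loc_lipschitz_row_mx (R : realType) N k l (D : set 'rV[R]_N)
    (F : 'rV[R]_N -> 'rV[R]_k) (G : 'rV[R]_N -> 'rV[R]_l) :
  loc_lipschitz_on D F -> loc_lipschitz_on D G ->
  loc_lipschitz_on D (fun z => row_mx (F z) (G z)).
Proof.
move=> lF lG z Dz.
have [r [L [r0 L0 FL]]] := loc_lipschitz_shrink lF Dz.
have [s [M [s0 M0 GM]]] := loc_lipschitz_shrink lG Dz.
pose q := Num.min r s.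
have qr : q <= r by rewrite ge_min lexx.
have qs : q <= s by rewrite ge_min lexx orbT.
exists q, (L + M); split => [|a b qa qb]; first by rewrite lt_min r0.
rewrite opp_row_mx add_row_mx (le_trans (mx_norm_row_mx _ _))// mulrDl.
by rewrite lerD// ?(FL _ qr)// (GM _ qs).
Qed.

Lemma loc_lipschitz_subZ (R : realType) N k (D : set 'rV[R]_N) c
    (F G : 'rV[R]_N -> 'rV[R]_k) :
  loc_lipschitz_on D F -> loc_lipschitz_on D G ->
  loc_lipschitz_on D (fun z => F z - c *: G z).
Proof.
move=> lF lG z Dz.
have [r [L [r0 L0 FL]]] := loc_lipschitz_shrink lF Dz.
have [s [M [s0 M0 GM]]] := loc_lipschitz_shrink lG Dz.
pose q := Num.min r s.
have qr : q <= r by rewrite ge_min lexx.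
have qs : q <= s by rewrite ge_min lexx orbT.
exists q, (L + `|c| * M); split => [|a b qa qb]; first by rewrite lt_min r0.
have -> : F a - c *: G a - (F b - c *: G b) = (F a - F b) - c *: (G a - G b).
  by apply/matrixP => i j; rewrite !mxE; ring.
rewrite (le_trans (ler_normB _ _))// mulrDl normrZ lerD// ?(FL _ qr)//.
by rewrite -mulrA ler_wpM2l// (GM _ qs).
Qed.

Lemma loc_lipschitz_cvg (R : realType) N k (D : set 'rV[R]_N) (F : 'rV[R]_N -> 'rV[R]_k)
    (u : nat -> 'rV[R]_N) z :
  loc_lipschitz_on D F -> D z -> u @ \oo --> z -> (fun j => F (u j)) @ \oo --> F z.
Proof.
move=> lF Dz uz; have [r [L [r0 L0 FL]]] := loc_lipschitz_shrink lF Dz.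
have L1 : 0 < 1 + L by rewrite ltr_pwDl.
apply/cvgrPdist_lt => e e0.
pose q := Num.min r (e / (1 + L)).
have q0 : 0 < q by rewrite lt_min r0 divr_gt0.
have qr : q <= r by rewrite ge_min lexx.
have [n _ un] : \forall j \near \oo, ball z q (u j) by apply: uz; exact: nbhsx_ballx.
exists n => // j /un /= qu.
apply: (le_lt_trans (FL _ qr _ _ (ballxx _ q0) qu)).
move: qu; rewrite -ball_normE/= lt_min ltr_pdivlMr// => /andP[_]; apply: le_lt_trans.
by rewrite mulrC ler_wpM2l// lerDr.
Qed.

Lemma abs_cont_dist (R : realType) N (c : R -> 'rV[R]_N) e : abs_cont_curve c -> 0 < e ->
  exists2 d, 0 < d & forall s t, 0 <= s <= 1 -> 0 <= t <= 1 -> `|s - t| < d ->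
    `|c s - c t| < e.
Proof.
move=> cA e0; have [d [d0 cd]] := cA e e0; exists d => // s t s01 t01.
wlog st : s t s01 t01 / t <= s.
  move=> H; have [/H|/ltW/H] := leP t s; first exact.
  by rewrite distrC (distrC (c s)); exact.
move=> std; have := cd 1%N (fun=> t) (fun=> s).
rewrite !big_ord1 => cd1; apply: cd1 => [_|i j|].
- by case/andP: s01; case/andP: t01.
- by rewrite !ord1.
- by rewrite (le_lt_trans _ std)// ler_norm.
Qed.

(** Compactness of [[0, 1]] makes the local Lipschitz constants uniform along the curve for times
    close to each other. *)
Lemma abs_cont_comp (R : realType) N k (D : set 'rV[R]_N) (F : 'rV[R]_N -> 'rV[R]_k)
    (c : R -> 'rV[R]_N) :
  loc_lipschitz_on D F -> abs_cont_curve c -> (forall t, 0 <= t <= 1 -> D (c t)) ->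
  abs_cont_curve (fun t => F (c t)).
Proof.
move=> lF cA cD.
(* A single parameter is both time radius and inverse Lipschitz constant; [P] weakens as [d]
   decreases to 0, so the covering argument yields one [d] for all [s]. *)
pose P (d s : R) := forall t, 0 <= t <= 1 -> `|s - t| <= d ->
  `|F (c s) - F (c t)| <= d^-1 * `|c s - c t|.
have /compact_near_coveringP/near_covering_withinP cov := @segment_compact R 0 1.
have : \forall d \near (0 : R)^'+, `[0, 1]%classic `<=` P d.
  apply: cov => x /=; rewrite in_itv/= => x01.
  have [r [L [r0 L0 FL]]] := loc_lipschitz_shrink lF (cD x x01).
  have [d d0 cd] := abs_cont_dist cA r0.
  have L1 : 0 < 1 + L by rewrite ltr_pwDl.
  have d2 : 0 < d / 2 by rewrite divr_gt0.
  near=> x' e => /=; rewrite in_itv/= => x'01 t t01 x't.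
  have e0 : 0 < e by near: e; exact: nbhs_right_gt.
  have xx' : `|x - x'| < d / 2.
    by near: x'; have := nbhsx_ballx x _ d2; rewrite -ball_normE.
  have ed : e < d / 2 by near: e; exact: nbhs_right_lt.
  have eL : e < (1 + L)^-1 by near: e; apply: nbhs_right_lt; rewrite invr_gt0.
  apply: le_trans (FL _ (lexx _) _ _ _ _) _.
  - by rewrite -ball_normE/=; apply: cd => //; rewrite (lt_trans xx')// gtr_pMr// invf_lt1// ltr1n.
  - rewrite -ball_normE/=; apply: cd => //.
    have -> : x - t = (x - x') + (x' - t) by rewrite addrA subrK.
    by rewrite (le_lt_trans (ler_normD _ _))// [d]splitr ltrD// (le_lt_trans x't).
  - rewrite ler_wpM2r// (@le_trans _ _ (1 + L)) ?lerDr//.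
    by rewrite -[leLHS]invrK lef_pV2 ?posrE ?invr_gt0// ltW.
move=> covd.
have [d [d0 dP]] : exists d : R, 0 < d /\ forall s, 0 <= s <= 1 -> P d s.
  near (0 : R)^'+ => d; exists d; split; first by near: d; exact: nbhs_right_gt.
  move=> s s01; have : `[0, 1]%classic `<=` P d by near: d.
  by apply; rewrite /= in_itv.
move=> e e0; have ed : 0 < d * e by rewrite mulr_gt0.
have [h [h0 ch]] := cA _ ed.
exists (Num.min h d); split; first by rewrite lt_min h0.
move=> l a b ab abl; rewrite lt_min => /andP[sh sd].
apply: (@le_lt_trans _ _ (\sum_i d^-1 * `|c (b i) - c (a i)|)); last first.
  by rewrite -mulr_sumr ltr_pdivrMl//; exact: ch.
apply: ler_sum => i _; have [a0 [aib b1]] := ab i.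
apply: dP; rewrite ?(a0, b1, le_trans a0 aib, le_trans aib b1)//.
rewrite ger0_norm ?subr_ge0// ltW// (le_lt_trans _ sd)//.
rewrite (bigD1 i)//= lerDl sumr_ge0// => j _.
by rewrite subr_ge0; have [_ []] := ab j.
Unshelve. all: by end_near. Qed.

Lemma derive_row_mx (R : realType) n m (f : R -> 'rV[R]_n) (h : R -> 'rV[R]_m) t :
  derivable (fun s => row_mx (f s) (h s)) t 1 ->
  [/\ derivable f t 1, derivable h t 1 &
    'D_1 (fun s => row_mx (f s) (h s)) t = row_mx ('D_1 f t) ('D_1 h t)].
Proof.
move=> d; have df : derivable f t 1.
  apply/derivable_mxP => i j; have /derivable_mxP/(_ i (lshift m j)) := d.
  by under [fun x => _]eq_fun do rewrite row_mxEl.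
have dh : derivable h t 1.
  apply/derivable_mxP => i j; have /derivable_mxP/(_ i (rshift n j)) := d.
  by under [fun x => _]eq_fun do rewrite row_mxEr.
split => //; rewrite !derive_mx//; apply/rowP => j; rewrite mxE.
rewrite -(splitK j); case: (fintype.split j) => k /=.
  by rewrite row_mxEl mxE; under eq_fun do rewrite row_mxEl.
by rewrite row_mxEr mxE; under eq_fun do rewrite row_mxEr.
Qed.

(** * Lipschitz estimates for the forward-backward step and its Clarke blocks *)

(** The claim amounts to [(gam beta)^2 < 2 gam alpha + (gam alpha)^2]. The step-size condition times
    [gam] gives [gam^2 (alpha + beta)^2 < 2 gam alpha], and the left side dominates
    [(gam beta)^2]. *)
Lemma contraction_rate (R : realType) (alpha beta gam : R) :
  0 < alpha -> 0 < beta -> 0 < gam -> gam < 2 * alpha / (alpha + beta) ^+ 2 ->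
  (1 + gam * alpha)^-1 * Num.sqrt (1 + (gam * beta) ^+ 2) < 1.
Proof.
move=> a0 b0 g0; rewrite ltr_pdivlMr ?exprn_gt0 ?addr_gt0// => gab.
have ga : 0 < gam * alpha by rewrite mulr_gt0.
have gb : 0 < gam * beta by rewrite mulr_gt0.
have ga1 : 0 < 1 + gam * alpha by rewrite ltr_pwDl// ltW.
rewrite ltr_pdivrMl// mulr1 -[ltRHS]ger0_norm ?(ltW ga1)// -sqrtr_sqr.
rewrite ltr_sqrt ?exprn_gt0//.
have : gam * (gam * (alpha + beta) ^+ 2) < gam * (2 * alpha) by rewrite ltr_pM2l.
have : 0 < gam * alpha * (gam * beta) by rewrite mulr_gt0.
have : 0 <= (gam * alpha) ^+ 2 by rewrite sqr_ge0.
lra.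
Qed.

Lemma enorm_row_mx (R : realType) n m (a : 'rV[R]_n) (b : 'rV[R]_m) :
  enorm (row_mx a b) ^+ 2 = enorm a ^+ 2 + enorm b ^+ 2.
Proof. by rewrite !enorm_sqr dotv_row_mx. Qed.

Lemma enorm_le_sqr (R : realType) n m (u : 'rV[R]_n) (v : 'rV[R]_m) c :
  0 <= c -> enorm u ^+ 2 <= c ^+ 2 * enorm v ^+ 2 -> enorm u <= c * enorm v.
Proof.
by move=> c0; rewrite -exprMn ler_pXn2r// nnegrE ?mulr_ge0 ?enorm_ge0.
Qed.

Lemma Tmap_lipschitz (R : realType) p n m (gam alpha : R)
    (g : 'rV[R]_p -> 'rV[R]_n -> \bar R) (fs : 'rV[R]_p -> 'rV[R]_m -> \bar R)
    (th : 'rV[R]_p) (w w' : 'rV[R]_(n + m)) :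
  0 < gam -> 0 < alpha ->
  closed_fun (g th) -> proper_fun (g th) -> strongly_convex alpha (g th) ->
  closed_fun (fs th) -> proper_fun (fs th) -> strongly_convex alpha (fs th) ->
  enorm (Tmap gam g fs (row_mx th w) - Tmap gam g fs (row_mx th w')) <=
    (1 + gam * alpha)^-1 * enorm (w - w').
Proof.
move=> g0 a0 cg pg sg cf pf sf; rewrite /Tmap !row_mxKl !row_mxKr.
have ga : 0 <= gam * alpha by rewrite mulr_ge0// ltW.
have ga1 : 0 < 1 + gam * alpha by rewrite ltr_pwDl.
have gai : 0 <= (1 + gam * alpha)^-1 by rewrite invr_ge0 ltW.
rewrite opp_row_mx add_row_mx; apply: enorm_le_sqr => //.
rewrite enorm_row_mx -(hsubmxK w) -(hsubmxK w') opp_row_mx add_row_mx enorm_row_mx.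
rewrite !row_mxKl !row_mxKr mulrDr -!exprMn.
by apply: lerD; rewrite ler_pXn2r ?nnegrE ?mulr_ge0 ?enorm_ge0// ler_pdivlMl//;
  apply: prox_lipschitz => //; first [exact: closed_scale|exact: proper_scale
    |exact: strongly_convex_scale].
Qed.

Lemma Bmap_sub (R : realType) p n m (K : 'rV[R]_p -> 'M[R]_(m, n)) th
    (a b : 'rV[R]_(n + m)) :
  Bmap K (row_mx th a) - Bmap K (row_mx th b) = Bmap K (row_mx th (a - b)).
Proof.
rewrite /Bmap !row_mxKl !row_mxKr opp_row_mx add_row_mx !linearB/=.
by rewrite !mulmxBl opprB opprK [- _ + _]addrC.
Qed.

Lemma BmapZ (R : realType) p n m (K : 'rV[R]_p -> 'M[R]_(m, n)) th c
    (a : 'rV[R]_(n + m)) :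
  Bmap K (row_mx th (c *: a)) = c *: Bmap K (row_mx th a).
Proof.
by rewrite /Bmap !row_mxKl !row_mxKr scale_row_mx !linearZ/= -!scalemxAl scalerN.
Qed.

Lemma Bmap_step_le (R : realType) p n m (K : 'rV[R]_p -> 'M[R]_(m, n)) th
    (gam beta : R) (z : 'rV[R]_(n + m)) :
  opnorm (K th) <= beta -> 0 <= beta ->
  enorm (z - gam *: Bmap K (row_mx th z)) <=
    Num.sqrt (1 + (gam * beta) ^+ 2) * enorm z.
Proof.
move=> Kb b0; apply: enorm_le_sqr; first exact: sqrtr_ge0.
rewrite [X in _ <= X * _]sqr_sqrtr ?addr_ge0 ?sqr_ge0//.
rewrite enormB_sqr dotvZr enormZ exprMn real_normK ?num_real//.
have -> : dotv z (Bmap K (row_mx th z)) = 0.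
  rewrite -{1}(hsubmxK z) /Bmap dotv_row_mx !row_mxKl !row_mxKr dotvNr.
  by rewrite (dotvC (rsubmx z)) dotv_mul_tr subrr.
rewrite !mulr0 subr0. 
have -> : (1 + (gam * beta) ^+ 2) * enorm z ^+ 2 =
  enorm z ^+ 2 + gam ^+ 2 * (beta ^+ 2 * enorm z ^+ 2) by ring.
rewrite lerD2l ler_wpM2l ?sqr_ge0//.
rewrite /Bmap !row_mxKl !row_mxKr -[in leRHS](hsubmxK z) !enorm_row_mx enormN.
rewrite addrC mulrDr -!exprMn.
by apply: lerD; rewrite ler_pXn2r ?nnegrE ?mulr_ge0 ?enorm_ge0//;
  [rewrite (le_trans (enorm_opnorm _ _))// ler_wpM2r ?enorm_ge0|exact: enorm_mul_le].
Qed.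

Lemma lin_block (R : realType) k p N (U : 'M[R]_(k, p)) (V : 'M[R]_(k, N))
    (a : 'rV[R]_p) (b : 'rV[R]_N) :
  row_mx a b *m (row_mx U V)^T = a *m U^T + b *m V^T.
Proof. by rewrite tr_row_mx mul_row_col. Qed.

Lemma open_lsubmx (R : realType) p N (Theta : set 'rV[R]_p) : open Theta ->
  open [set w : 'rV[R]_(p + N) | Theta (lsubmx w)].
Proof.
by move=> oT; apply: open_comp => // w _; exact: continuous_lsubmx.
Qed.

(** Direction [(0, h)] isolates the block [V]. The points defining the Clarke Jacobian vary in
    [theta] as well, so the increment bound is asked uniformly over [Theta], with [theta] fixed
    within each increment. *)
Lemma clarke_block_le (R : realType) p N k (Theta : set 'rV[R]_p)
    (F : 'rV[R]_(p + N) -> 'rV[R]_k) th w U V (h : 'rV[R]_N) y b :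
  open Theta -> Theta th ->
  (forall th' w' t, Theta th' -> 0 < t ->
    dotv (F (row_mx th' (t *: h + w')) - F (row_mx th' w')) y <= t * b) ->
  clarke F (row_mx th w) (row_mx U V) -> dotv (h *m V^T) y <= b.
Proof.
move=> oT Tth Fh cUV.
have -> : h *m V^T = row_mx 0 h *m (row_mx U V)^T by rewrite lin_block mul0mx add0r.
apply: clarke_dir_le cUV.
have : nbhs (row_mx th w) [set w : 'rV[R]_(p + N) | Theta (lsubmx w)].
  by apply: open_nbhs_nbhs; split; [exact: open_lsubmx|rewrite /= row_mxKl].
apply: filterS => z' Tz'; near=> t.
have t0 : 0 < t by near: t; exact: nbhs_right_gt.
rewrite -(hsubmxK z') scale_row_mx scaler0 add_row_mx add0r.
exact: Fh.
Unshelve. all: by end_near. Qed.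

(** The equation for [v] reads [v = b + (v - gam v Z^T) V^T], whose last term has norm at most
    [rho * sigma] times that of [v]. Taking [b = 0] gives a trivial kernel; the quantitative bound
    serves for local boundedness of the Jacobian. *)
Lemma fixed_point_unit (R : realType) N (V Z : 'M[R]_N) (gam rho sigma : R) :
  rho * sigma < 1 -> 0 <= rho ->
  (forall h : 'rV[R]_N, enorm (h *m V^T) <= rho * enorm h) ->
  (forall h : 'rV[R]_N, enorm (h - gam *: (h *m Z^T)) <= sigma * enorm h) ->
  (1%:M - V *m (1%:M - gam *: Z)) \in unitmx /\
  forall v b : 'rV[R]_N, v *m (1%:M - V *m (1%:M - gam *: Z))^T = b ->
    enorm v <= enorm b / (1 - rho * sigma).
Proof.
move=> rs1 rho0 hV hZ.
have key (v b : 'rV[R]_N) : v *m (1%:M - V *m (1%:M - gam *: Z))^T = b ->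
    enorm v <= enorm b / (1 - rho * sigma).
  have -> : (1%:M - V *m (1%:M - gam *: Z))^T = 1%:M - (1%:M - gam *: Z^T) *m V^T.
    by rewrite [LHS]linearB/= trmx1 trmx_mul [in LHS]linearB/= trmx1 [in LHS]linearZ.
  rewrite mulmxBr mulmx1 mulmxA [v *m (1%:M - _)]mulmxBr mulmx1 -scalemxAr => vb.
  rewrite ler_pdivlMr ?subr_gt0// mulrBr mulr1 lerBlDr.
  have := le_trans (hV _) (ler_wpM2l rho0 (hZ v)); rewrite mulrA => Vv.
  have := enormD b ((v - gam *: (v *m Z^T)) *m V^T).
  have -> : b + (v - gam *: (v *m Z^T)) *m V^T = v by rewrite -vb subrK.
  by rewrite mulrC; lra.
split => //; rewrite -unitmx_tr -row_free_unit -kermx_eq0; apply/eqP/row_matrixP => i.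
rewrite row0; set v := row i _.
have : v *m (1%:M - V *m (1%:M - gam *: Z))^T = 0 by rewrite -row_mul mulmx_ker row0.
have e0 : enorm (0 : 'rV[R]_N) = 0 by rewrite -(scale0r (0 : 'rV[R]_N)) enormZ normr0 mul0r.
move=> /key; rewrite e0 mul0r => v0.
by apply: enorm0_eq0; apply/eqP; rewrite eq_le v0 enorm_ge0.
Qed.

Definition pd_step (R : realType) p n m (gam : R) (g : 'rV[R]_p -> 'rV[R]_n -> \bar R)
    (fs : 'rV[R]_p -> 'rV[R]_m -> \bar R) (K : 'rV[R]_p -> 'M[R]_(m, n))
    (th : 'rV[R]_p) (z : 'rV[R]_(n + m)) :=
  Tmap gam g fs (row_mx th (z - gam *: Bmap K (row_mx th z))).

(** At a fixed point, the argument of each prox minus its value is [gam] times the subgradient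
    prescribed by the optimality inclusions. *)
Lemma pd_step_fixed (R : realType) p n m (gam alpha : R)
    (g : 'rV[R]_p -> 'rV[R]_n -> \bar R) (fs : 'rV[R]_p -> 'rV[R]_m -> \bar R)
    (K : 'rV[R]_p -> 'M[R]_(m, n)) th x y :
  0 < gam -> 0 < alpha ->
  closed_fun (g th) -> proper_fun (g th) -> strongly_convex alpha (g th) ->
  closed_fun (fs th) -> proper_fun (fs th) -> strongly_convex alpha (fs th) ->
  pd_step gam g fs K th (row_mx x y) = row_mx x y <->
  is_saddle (g th) (fs th) (K th) x y.
Proof.
move=> g0 a0 cg pg sg cf pf sf; rewrite saddle_subdiff//.
rewrite /pd_step /Tmap /Bmap !row_mxKl !row_mxKr !row_mxKl scale_row_mx opp_row_mx add_row_mx.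
rewrite !row_mxKl !row_mxKr.
have Hx := prox_subdiff (x - gam *: (y *m K th)) x cg pg (ltW a0) sg g0.
have Hy := prox_subdiff (y - gam *: - (x *m (K th)^T)) y cf pf (ltW a0) sf g0.
have gn : gam != 0 by rewrite gt_eqF.
have ex : gam^-1 *: (x - gam *: (y *m K th) - x) = - (y *m K th).
  by rewrite addrAC subrr add0r scalerN scalerA mulVf// scale1r.
have ey : gam^-1 *: (y - gam *: - (x *m (K th)^T) - y) = x *m (K th)^T.
  by rewrite addrAC subrr add0r scalerN scalerA mulVf// scale1r opprK.
rewrite ex in Hx; rewrite ey in Hy; split.
  by move=> /eq_row_mx[/Hx ? /Hy ?].
by move=> [/Hy -> /Hx ->].
Qed.

(** * Regularity and implicit differentiation of a fixed point *)

Lemma mx_norm_mulmx (R : realType) a b c (A : 'M[R]_(a, b)) (B : 'M[R]_(b, c)) :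
  `|A *m B| <= b%:R * (`|A| * `|B|).
Proof.
apply: mx_norm_le_coord => [|i j]; first by rewrite !mulr_ge0.
rewrite mxE (le_trans (ler_norm_sum _ _ _))//.
apply: (@le_trans _ _ (\sum_(i < b) `|A| * `|B|)).
  by apply: ler_sum => l _; rewrite normrM ler_pM// mx_norm_ge_coord.
by rewrite sumr_const card_ord -[in leLHS]mulr_natl.
Qed.

Lemma cvg_mx (R : realType) (T : Type) (F : set_system T) {FF : Filter F}
    m n (f : T -> 'M[R]_(m, n)) (l : 'M[R]_(m, n)) :
  (forall i j, (fun x => f x i j) @ F --> l i j) -> f @ F --> l.
Proof.
move=> fl; apply/cvgrPdist_le => e e0.
have : \forall x \near F, forall ij : 'I_m * 'I_n, `|l ij.1 ij.2 - f x ij.1 ij.2| <= e.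
  by apply: filter_forall => -[i j] /=; move/cvgrPdist_le: (fl i j); apply.
apply: filterS => x H; apply: mx_norm_le_coord; first exact: ltW.
by move=> i j; have := H (i, j); rewrite !mxE.
Qed.

Lemma cvg_mulmx (R : realType) (T : Type) (F : set_system T) {FF : Filter F}
    a b c (f : T -> 'M[R]_(a, b)) (g : T -> 'M[R]_(b, c))
    (A : 'M[R]_(a, b)) (B : 'M[R]_(b, c)) :
  f @ F --> A -> g @ F --> B -> (fun x => f x *m g x) @ F --> A *m B.
Proof.
move=> fA gB; apply: cvg_mx => i j; rewrite mxE.
under eq_fun do rewrite mxE.
apply: cvg_big => [|l _]; first exact: add_continuous.
by apply: cvgM; exact: cvg_mx_coord.
Qed.

Lemma cvg_lsubmx (R : realType) (T : Type) (F : set_system T) {FF : Filter F}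
    k a b (f : T -> 'M[R]_(k, a + b)) (A : 'M[R]_(k, a + b)) :
  f @ F --> A -> (fun x => lsubmx (f x)) @ F --> lsubmx A.
Proof.
move=> fA; apply: cvg_mx => i j; rewrite mxE.
by under eq_fun do rewrite mxE; exact: cvg_mx_coord.
Qed.

Lemma cvg_rsubmx (R : realType) (T : Type) (F : set_system T) {FF : Filter F}
    k a b (f : T -> 'M[R]_(k, a + b)) (A : 'M[R]_(k, a + b)) :
  f @ F --> A -> (fun x => rsubmx (f x)) @ F --> rsubmx A.
Proof.
move=> fA; apply: cvg_mx => i j; rewrite mxE.
by under eq_fun do rewrite mxE; exact: cvg_mx_coord.
Qed.

Lemma loc_lipschitz_near (R : realType) N k (D : set 'rV[R]_N) (F : 'rV[R]_N -> 'rV[R]_k)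
    z e : loc_lipschitz_on D F -> D z -> 0 < e ->
  \forall z' \near z, ball (F z) e (F z').
Proof.
move=> lF Dz e0; have [r [L [r0 L0 FL]]] := loc_lipschitz_shrink lF Dz.
have L1 : 0 < 1 + L by rewrite ltr_pwDl.
pose q := Num.min r (e / (1 + L)).
have q0 : 0 < q by rewrite lt_min r0 divr_gt0.
have qr : q <= r by rewrite ge_min lexx.
apply/nbhs_ballP; exists q => //= z' qz'; rewrite -ball_normE/=.
apply: (le_lt_trans (FL _ qr _ _ (ballxx _ q0) qz')).
move: qz'; rewrite -ball_normE/= lt_min ltr_pdivlMr// => /andP[_]; apply: le_lt_trans.
by rewrite mulrC ler_wpM2l// lerDr.
Qed.

(** Inserting [Phi a (zs b)] between the two fixed points and absorbing the contraction leaves the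
    variation of [Phi] in the parameter alone, divided by [1 - q]. *)
Lemma fixed_point_loc_lipschitz (R : realType) p N (Theta : set 'rV[R]_p)
    (Phi : 'rV[R]_p -> 'rV[R]_N -> 'rV[R]_N) q (zs : 'rV[R]_p -> 'rV[R]_N) :
  open Theta -> q < 1 ->
  (forall th, Theta th -> forall a b, enorm (Phi th a - Phi th b) <= q * enorm (a - b)) ->
  loc_lipschitz_on [set w : 'rV[R]_(p + N) | Theta (lsubmx w)]
    (fun w => Phi (lsubmx w) (rsubmx w)) ->
  (forall th, Theta th -> Phi th (zs th) = zs th) ->
  loc_lipschitz_on Theta zs.
Proof.
move=> oT q1 Phiq lPhi fix_zs th0 Tth0.
have q1' : 0 < 1 - q by rewrite subr_gt0.
have dist a b : Theta a -> Theta b ->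
    `|zs a - zs b| <= enorm (Phi a (zs b) - Phi b (zs b)) / (1 - q).
  move=> Ta Tb; apply: (le_trans (mx_norm_le_enorm _)).
  rewrite ler_pdivlMr// mulrBr mulr1 lerBlDr.
  rewrite -{1}(fix_zs a Ta) -{1}(fix_zs b Tb).
  have -> : Phi a (zs a) - Phi b (zs b) =
    (Phi a (zs b) - Phi b (zs b)) + (Phi a (zs a) - Phi a (zs b)).
    by apply/matrixP => i j; rewrite !mxE; ring.
  by rewrite (le_trans (enormD _ _))// lerD2l mulrC Phiq.
pose w0 : 'rV[R]_(p + N) := row_mx th0 (zs th0).
have Tw0 : Theta (lsubmx w0) by rewrite row_mxKl.
have [r [L [r0 L0 FL]]] := loc_lipschitz_shrink lPhi Tw0.
have /nbhs_ballP[s /= s0 sT] : nbhs th0 Theta by exact: open_nbhs_nbhs.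
pose C : R := (1 + N%:R) * L / (1 - q).
have C0 : 0 <= C by rewrite divr_ge0 ?(ltW q1')// mulr_ge0// addr_ge0.
have C1 : 0 < 1 + C by rewrite ltr_pwDl.
have lip a b : Theta a -> Theta b -> ball w0 r (row_mx a (zs b)) ->
    ball w0 r (row_mx b (zs b)) -> `|zs a - zs b| <= C * `|a - b|.
  move=> Ta Tb ra rb; apply: (le_trans (dist a b Ta Tb)).
  rewrite /C mulrAC ler_pM2r ?invr_gt0// (le_trans (enorm_le_mx_norm _))// -mulrA.
  rewrite ler_wpM2l ?addr_ge0//.
  have := FL r (lexx _) _ _ ra rb; rewrite !row_mxKl !row_mxKr => /le_trans; apply.
  rewrite ler_wpM2l// opp_row_mx add_row_mx subrr (le_trans (mx_norm_row_mx _ _))//.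
  by rewrite normr0 addr0.
have r2 : 0 < r / 2 by rewrite divr_gt0.
have w0r a z : `|th0 - a| < r / 2 -> `|zs th0 - z| < r / 2 -> ball w0 r (row_mx a z).
  move=> ra rz; rewrite -ball_normE/= /w0 opp_row_mx add_row_mx.
  by rewrite (le_lt_trans (mx_norm_row_mx _ _))// [r]splitr ltrD.
pose d := Num.min s (Num.min (r / 2) (r / 2 / (1 + C))).
have d0 : 0 < d by rewrite !lt_min s0 r2 divr_gt0.
(* The Lipschitz constant of [Phi] is valid only near [(th0, zs th0)]. Comparison with [th0] itself
   first shows that [zs a] stays near [zs th0]; afterwards two arbitrary parameters can be
   compared. *)
have dP a : ball th0 d a -> [/\ Theta a, `|th0 - a| < r / 2 & `|zs th0 - zs a| < r / 2].
  move=> da; have Ta : Theta a by apply: sT; apply: le_ball da; rewrite ge_min lexx.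
  move: da; rewrite -ball_normE/= !lt_min => /and3P[_ ar arC]; split => //.
  rewrite distrC; apply: (@le_lt_trans _ _ (C * `|a - th0|)).
    by apply: lip => //; apply: w0r; rewrite ?subrr ?normr0.
  move: arC; rewrite ltr_pdivlMr// distrC; apply: le_lt_trans.
  by rewrite mulrC ler_wpM2l// lerDr.
exists d, C; split => // a b /dP[Ta ra za] /dP[Tb rb zb].
by apply: lip => //; apply: w0r.
Qed.

Lemma ae_and (R : realType) (P Q : R -> Prop) :
  {ae lebesgue_measure, forall t, P t} -> {ae lebesgue_measure, forall t, Q t} ->
  {ae lebesgue_measure, forall t, P t /\ Q t}.
Proof.
move=> hP hQ; apply: negligibleS (negligibleU hP hQ) => t /= nPQ.
by have [Pt|] := pselect (P t); [right => Qt; apply: nPQ|left].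
Qed.

Lemma ae_neq (R : realType) (a : R) : {ae lebesgue_measure, forall t : R, t != a}.
Proof.
exists [set a]; split; [exact: measurable_set1|exact: lebesgue_measure_set1|].
by move=> t /= /negP; rewrite negbK => /eqP.
Qed.

(** The formula in terms of the joint matrices [P = [U V]] and [Q = [W Z]], on which Clarke bounds
    and subsequence extraction act directly. *)
Definition implicit_jac (R : realType) p N (gam : R)
    (P Q : 'M[R]_(N, p + N)) : 'M[R]_(N, p) :=
  invmx (1%:M - rsubmx P *m (1%:M - gam *: rsubmx Q)) *m
    (lsubmx P - gam *: (rsubmx P *m lsubmx Q)).

Lemma implicit_jac_bound (R : realType) p N (gam q L1 L2 : R) (P Q : 'M[R]_(N, p + N)) :
  let A := 1%:M - rsubmx P *m (1%:M - gam *: rsubmx Q) in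
  A \in unitmx -> q < 1 ->
  (forall v b : 'rV[R]_N, v *m A^T = b -> enorm v <= enorm b / (1 - q)) ->
  `|P| <= L1 -> `|Q| <= L2 ->
  `|implicit_jac gam P Q| <=
    (1 + N%:R) * (L1 + `|gam| * (N%:R * (L1 * L2))) / (1 - q).
Proof.
move=> A uA q1 Ab PL QL; set M := implicit_jac _ _ _.
have L10 : 0 <= L1 by exact: le_trans PL.
have L20 : 0 <= L2 by exact: le_trans QL.
have q1' : 0 < 1 - q by rewrite subr_gt0.
pose B := lsubmx P - gam *: (rsubmx P *m lsubmx Q).
have BL : `|B| <= L1 + `|gam| * (N%:R * (L1 * L2)).
  rewrite (le_trans (ler_normB _ _))// lerD//; first exact: le_trans (mx_norm_lsubmx _) PL.
  rewrite normrZ ler_wpM2l// (le_trans (mx_norm_mulmx _ _))// ler_wpM2l//.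
  by rewrite ler_pM//; [exact: le_trans (mx_norm_rsubmx _) PL|exact: le_trans (mx_norm_lsubmx _) QL].
(* The inverse is never estimated: the columns of [M] solve a system whose solutions are bounded by
   [Ab]. *)
have AM : A *m M = B by rewrite /M /implicit_jac mulmxA mulmxV// mul1mx.
apply: mx_norm_le_coord => [|i j].
  by rewrite divr_ge0 ?(ltW q1')// mulr_ge0 ?addr_ge0 ?mulr_ge0.
have -> : M i j = (row j M^T) 0 i by rewrite !mxE.
rewrite (le_trans (mx_norm_ge_coord _ _ _))// (le_trans (mx_norm_le_enorm _))//.
have /Ab/le_trans : row j M^T *m A^T = row j B^T by rewrite -row_mul -trmx_mul AM.
apply; rewrite ler_pM2r ?invr_gt0// (le_trans (enorm_le_mx_norm _))// ler_wpM2l ?addr_ge0//.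
rewrite (le_trans _ BL)//; apply: mx_norm_le_coord => // i' j'.
have -> : row j B^T i' j' = B j' j by rewrite 2!mxE.
exact: mx_norm_ge_coord.
Qed.

(* Differentiating [T (th, zs - gam B(th, zs)) = zs] along a curve gives the
   linear system solved by [implicit_jac]. *)
Theorem implicit_conservative (R : realType) p N (Theta : set 'rV[R]_p) (gam rho sigma : R)
    (T B : 'rV[R]_(p + N) -> 'rV[R]_N) (zs : 'rV[R]_p -> 'rV[R]_N)
    (wT wB : 'rV[R]_p -> 'rV[R]_(p + N)) :
  let D := [set w : 'rV[R]_(p + N) | Theta (lsubmx w)] in
  open Theta -> path_diff_on D T -> path_diff_on D B ->
  (forall th, wB th = row_mx th (zs th)) ->
  (forall th, wT th = row_mx th (zs th - gam *: B (wB th))) ->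
  (forall th, Theta th -> T (wT th) = zs th) ->
  loc_lipschitz_on Theta zs -> rho * sigma < 1 -> 0 <= rho ->
  (forall th, Theta th -> forall U V, clarke T (wT th) (row_mx U V) ->
    forall h : 'rV[R]_N, enorm (h *m V^T) <= rho * enorm h) ->
  (forall th, Theta th -> forall W Z, clarke B (wB th) (row_mx W Z) ->
    forall h : 'rV[R]_N, enorm (h - gam *: (h *m Z^T)) <= sigma * enorm h) ->
  conservative_on Theta zs (fun th => [set M | exists U V W Z,
    clarke T (wT th) (row_mx U V) /\ clarke B (wB th) (row_mx W Z) /\
    M = invmx (1%:M - V *m (1%:M - gam *: Z)) *m (U - gam *: (V *m W))]).
Proof.
move=> D oTheta pT pB wBE wTE Tfix lzs rs1 rho0 hV hZ.
have oD : open D by exact: open_lsubmx.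
have cT := clarke_conservative oD pT; have cB := clarke_conservative oD pB.
have DB th : Theta th -> D (wB th) by rewrite /D/= wBE row_mxKl.
have DT th : Theta th -> D (wT th) by rewrite /D/= wTE row_mxKl.
have lid : loc_lipschitz_on Theta (fun th : 'rV[R]_p => th) by exact: loc_lipschitz_lip1.
have lwB : loc_lipschitz_on Theta wB.
  by rewrite (_ : wB = fun th => row_mx th (zs th)); [exact: loc_lipschitz_row_mx|exact/funext].
have lwT : loc_lipschitz_on Theta wT.
  rewrite (_ : wT = fun th => row_mx th (zs th - gam *: B (wB th))); last exact/funext.
  apply: loc_lipschitz_row_mx => //; apply: loc_lipschitz_subZ => //.
  exact: loc_lipschitz_comp lwB pB.1 DB.
have unit_bound th P Q : Theta th -> clarke T (wT th) P -> clarke B (wB th) Q ->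
    (1%:M - rsubmx P *m (1%:M - gam *: rsubmx Q)) \in unitmx /\
    forall v b : 'rV[R]_N, v *m (1%:M - rsubmx P *m (1%:M - gam *: rsubmx Q))^T = b ->
      enorm v <= enorm b / (1 - rho * sigma).
  move=> Tth cP cQ; apply: fixed_point_unit => //.
    by apply: (hV th Tth (lsubmx P)); rewrite hsubmxK.
  by apply: (hZ th Tth (lsubmx Q)); rewrite hsubmxK.
have JE th M : (exists U V W Z, clarke T (wT th) (row_mx U V) /\
      clarke B (wB th) (row_mx W Z) /\
      M = invmx (1%:M - V *m (1%:M - gam *: Z)) *m (U - gam *: (V *m W))) <->
    exists P Q, [/\ clarke T (wT th) P, clarke B (wB th) Q & M = implicit_jac gam P Q].
  split.
    move=> [U [V [W [Z [cUV [cWZ ->]]]]]]; exists (row_mx U V), (row_mx W Z).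
    by split => //; rewrite /implicit_jac !row_mxKl !row_mxKr.
  move=> [P [Q [cP cQ ->]]]; exists (lsubmx P), (rsubmx P), (lsubmx Q), (rsubmx Q).
  by rewrite !hsubmxK.
have bounded th : Theta th -> exists b : R, \forall th' \near th, forall M,
    (exists P Q, [/\ clarke T (wT th') P, clarke B (wB th') Q & M = implicit_jac gam P Q]) ->
    `|M| <= b.
  move=> Tth.
  have [r1 [L1 [r10 L10 _ FL1]]] := loc_lipschitz_ball oD pT.1 (DT th Tth).
  have [r2 [L2 [r20 L20 _ FL2]]] := loc_lipschitz_ball oD pB.1 (DB th Tth).
  exists ((1 + N%:R) * (L1 + `|gam| * (N%:R * (L1 * L2))) / (1 - rho * sigma)).
  have n0 : nbhs th Theta by exact: open_nbhs_nbhs.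
  have n1 := loc_lipschitz_near lwT Tth r10.
  have n2 := loc_lipschitz_near lwB Tth r20.
  apply: filterS (filterI n0 (filterI n1 n2)) => th' [Tth' [b1 b2]] M [P [Q [cP cQ ->]]].
  have [uA Ab] := unit_bound th' P Q Tth' cP cQ.
  apply: implicit_jac_bound => //; first exact: clarke_norm_le FL1 L10 b1 cP.
  exact: clarke_norm_le FL2 L20 b2 cQ.
split.
  move=> th Tth; have [P cP] := cT.1 _ (DT th Tth); have [Q cQ] := cB.1 _ (DB th Tth).
  by exists (implicit_jac gam P Q); apply/JE; exists P, Q.
split.
  move=> th /bounded[b bP]; exists b; apply: filterS bP => th' H M /JE; exact: H.
split.
  move=> u Ms th M Tth Tu JM uth MsM.
  have [r1 [L1 [r10 L10 _ FL1]]] := loc_lipschitz_ball oD pT.1 (DT th Tth).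
  have [r2 [L2 [r20 L20 _ FL2]]] := loc_lipschitz_ball oD pB.1 (DB th Tth).
  have wTu : (fun j => wT (u j)) @ \oo --> wT th by exact: loc_lipschitz_cvg lwT Tth uth.
  have wBu : (fun j => wB (u j)) @ \oo --> wB th by exact: loc_lipschitz_cvg lwB Tth uth.
  have [n1 _ nT] : \forall j \near \oo, ball (wT th) r1 (wT (u j)).
    by apply: wTu; exact: nbhsx_ballx.
  have [n2 _ nB] : \forall j \near \oo, ball (wB th) r2 (wB (u j)).
    by apply: wBu; exact: nbhsx_ballx.
  (* From this index on both evaluation points lie in the Lipschitz balls, which bounds the Clarke
     matrices. *)
  pose n0 := maxn n1 n2.
  have /choice[PQ PQP] : forall j, exists PQ : 'M[R]_(N, p + N) * 'M[R]_(N, p + N),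
      [/\ clarke T (wT (u (n0 + j)%N)) PQ.1, clarke B (wB (u (n0 + j)%N)) PQ.2 &
        Ms (n0 + j)%N = implicit_jac gam PQ.1 PQ.2].
    by move=> j; have /JE[P [Q H]] := JM (n0 + j)%N; exists (P, Q).
  have [f fk /cvg_ex[P fP]] : exists2 f : nat -> nat, (forall k, (k <= f k)%N)
      & cvgn ((fun j => (PQ j).1) \o f).
    apply: (@bounded_cvg_subseq _ _ _ _ L1) => j; have [c1 _ _] := PQP j.
    apply: clarke_norm_le FL1 L10 _ c1; apply: nT => /=.
    by rewrite (leq_trans (leq_maxl n1 n2))// leq_addr.
  have [h hk /cvg_ex[Q hQ]] : exists2 h : nat -> nat, (forall k, (k <= h k)%N)
      & cvgn ((fun j => (PQ (f j)).2) \o h).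
    apply: (@bounded_cvg_subseq _ _ _ _ L2) => j; have [_ c2 _] := PQP (f j).
    apply: clarke_norm_le FL2 L20 _ c2; apply: nB => /=.
    by rewrite (leq_trans (leq_maxr n1 n2))// leq_addr.
  have {}fP : (fun j => (PQ (f (h j))).1) @ \oo --> P by exact: (cvg_subseq hk fP).
  have nfh j : (j <= n0 + f (h j))%N.
    by rewrite (leq_trans (hk j))// (leq_trans (fk _))// leq_addl.
  have cP : clarke T (wT th) P.
    apply: (clarke_closed_graph (u := fun j => wT (u (n0 + f (h j))%N)) oD pT.1 (DT th Tth) _ _ fP).
      by move=> j; have [] := PQP (f (h j)).
    exact: (cvg_subseq nfh wTu).
  have cQ : clarke B (wB th) Q.
    apply: (clarke_closed_graph (u := fun j => wB (u (n0 + f (h j))%N)) oD pB.1 (DB th Tth) _ _ hQ).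
      by move=> j; have [] := PQP (f (h j)).
    exact: (cvg_subseq nfh wBu).
  apply/JE; exists P, Q; split => //.
  have [uA _] := unit_bound th P Q Tth cP cQ.
  have MM : (fun j => Ms (n0 + f (h j))%N) @ \oo --> M by exact: (cvg_subseq nfh MsM).
  have Pr := @cvg_rsubmx _ _ _ eventually_filter _ _ _ _ _ fP; have Pl := @cvg_lsubmx _ _ _ eventually_filter _ _ _ _ _ fP.
  have Qr := @cvg_rsubmx _ _ _ eventually_filter _ _ _ _ _ hQ; have Ql := @cvg_lsubmx _ _ _ eventually_filter _ _ _ _ _ hQ.
  (* The limit is taken in the linear system satisfied by [Ms], and the inversion is done only at
     the limit, so continuity of [invmx] is not at issue. *)
  have lhs : (fun j => (1%:M - rsubmx (PQ (f (h j))).1 *m (1%:M - gam *: rsubmx (PQ (f (h j))).2))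
      *m Ms (n0 + f (h j))%N) @ \oo -->
      (1%:M - rsubmx P *m (1%:M - gam *: rsubmx Q)) *m M.
    have inner : (fun j => 1%:M - gam *: rsubmx (PQ (f (h j))).2) @ \oo -->
        (1%:M - gam *: rsubmx Q : 'M[R]_N).
      by apply: cvgB; [exact: cvg_cst|apply: cvgZ; [exact: cvg_cst|exact: Qr]].
    have VI := @cvg_mulmx _ _ _ eventually_filter _ _ _ _ _ _ _ Pr inner.
    apply: cvg_mulmx MM; apply: cvgB; first exact: cvg_cst.
    exact: VI.
  have rhs : (fun j => lsubmx (PQ (f (h j))).1 - gam *: (rsubmx (PQ (f (h j))).1 *m
      lsubmx (PQ (f (h j))).2)) @ \oo --> lsubmx P - gam *: (rsubmx P *m lsubmx Q).
    have VW := @cvg_mulmx _ _ _ eventually_filter _ _ _ _ _ _ _ Pr Ql.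
    by apply: cvgB; [exact: Pl|apply: cvgZ; [exact: cvg_cst|exact: VW]].
  have : (1%:M - rsubmx P *m (1%:M - gam *: rsubmx Q)) *m M =
      lsubmx P - gam *: (rsubmx P *m lsubmx Q).
    apply: (norm_cvg_unique lhs); apply: cvg_trans rhs; apply: near_eq_cvg.
    apply: nearW => j /=.
    have [c1 c2 ->] := PQP (f (h j)).
    have [u1 _] := unit_bound _ _ _ (Tu _) c1 c2.
    by rewrite /implicit_jac mulmxA mulmxV// mul1mx.
  by rewrite /implicit_jac => <-; rewrite mulmxA mulVmx// mul1mx.
move=> c cA cTheta.
have aT : abs_cont_curve (fun t => wT (c t)) by exact: abs_cont_comp lwT cA cTheta.
have aB : abs_cont_curve (fun t => wB (c t)) by exact: abs_cont_comp lwB cA cTheta.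
have aeT := cT.2.2.2 _ aT (fun t t01 => DT _ (cTheta t t01)).
have aeB := cB.2.2.2 _ aB (fun t t01 => DB _ (cTheta t t01)).
(* The curve is in [Theta] only for times in [[0, 1]], so the fixed-point identity holds on a
   neighbourhood of [t] only away from the endpoints. *)
apply: ae_imply (ae_and (ae_and aeT aeB) (ae_and (ae_neq 0) (ae_neq 1))).
move=> t [[HT HB] [t0 t1]] t01.
have [dwT [dT MT]] := HT t01; have [dwB [dB MB]] := HB t01.
have t01' : 0 <= t <= 1 by move: t01; rewrite /= in_itv.
have Tct := cTheta t t01'.
have zsn : \forall s \near t, T (wT (c s)) = zs (c s).
  have : nbhs t `]0, 1[%classic.
    apply: open_nbhs_nbhs; split; first exact: interval_open.
    move: t01' => /andP[tg0 tl1]; rewrite /= in_itv/= !lt_neqAle tg0 tl1 t1.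
    by rewrite eq_sym t0.
  apply: filterS => s /=; rewrite in_itv/= => /andP[/ltW s0 /ltW s1].
  by apply: Tfix; apply: cTheta; rewrite s0.
have dz : derivable (zs \o c) t 1 by exact: near_eq_derivable zsn dT.
have dzE : 'D_1 (zs \o c) t = 'D_1 (T \o (fun t => wT (c t))) t.
  by apply/esym; exact: near_eq_derive.
have wBc : (fun t => wB (c t)) = fun t => row_mx (c t) ((zs \o c) t).
  by apply/funext => s; rewrite wBE.
have wTc : (fun t => wT (c t)) = fun t => row_mx (c t) ((zs \o c - gam \*: (B \o (fun t => wB (c t)))) t).
  by apply/funext => s; rewrite wTE.
have dc : derivable c t 1.
  by move: dwB; rewrite wBc => /derive_row_mx[].
split => //; split => // M /JE[P [Q [cP cQ ->]]].
have [uA _] := unit_bound _ _ _ Tct cP cQ.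
have dBE : 'D_1 (fun t => wB (c t)) t = row_mx ('D_1 c t) ('D_1 (zs \o c) t).
  by move: dwB; rewrite wBc => /derive_row_mx[].
have dTE : 'D_1 (fun t => wT (c t)) t = row_mx ('D_1 c t)
    ('D_1 (zs \o c) t - gam *: 'D_1 (B \o (fun t => wB (c t))) t).
  move: dwT; rewrite wTc => /derive_row_mx[_ _ ->]; congr row_mx.
  have dgB := derivableZ (k := gam) dB.
  by rewrite (deriveB dz dgB) (deriveZ gam dB).
have := MT P cP; rewrite -dzE dTE -(hsubmxK P) lin_block hsubmxK.
rewrite (MB Q cQ) dBE -{1}(hsubmxK Q) lin_block.
set z' := 'D_1 (zs \o c) t; set c' := 'D_1 c t => z'E.
(* Substituting the chain rule for [B] into that for [T] leaves a linear equation for the velocity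
   [z'] of the fixed point. *)
suff : z' *m (1%:M - rsubmx P *m (1%:M - gam *: rsubmx Q))^T =
    c' *m (lsubmx P - gam *: (rsubmx P *m lsubmx Q))^T.
  move=> H; rewrite /implicit_jac trmx_mul mulmxA -H -mulmxA -trmx_mul mulVmx//.
  by rewrite trmx1 mulmx1.
have -> : (1%:M - rsubmx P *m (1%:M - gam *: rsubmx Q))^T =
    1%:M - (1%:M - gam *: (rsubmx Q)^T) *m (rsubmx P)^T.
  by rewrite [LHS]linearB/= trmx1 trmx_mul [in LHS]linearB/= trmx1 [in LHS]linearZ.
have -> : (lsubmx P - gam *: (rsubmx P *m lsubmx Q))^T =
    (lsubmx P)^T - gam *: ((lsubmx Q)^T *m (rsubmx P)^T).
  by rewrite [LHS]linearB/= [in LHS]linearZ/= trmx_mul.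
have -> : z' *m (1%:M - (1%:M - gam *: (rsubmx Q)^T) *m (rsubmx P)^T) =
    z' - (z' - gam *: (z' *m (rsubmx Q)^T)) *m (rsubmx P)^T.
  by rewrite mulmxBr mulmx1 mulmxA [z' *m (_ - _)]mulmxBr mulmx1 -scalemxAr.
rewrite {1}z'E -addrA -mulmxBl.
have -> : z' - gam *: (c' *m (lsubmx Q)^T + z' *m (rsubmx Q)^T) -
    (z' - gam *: (z' *m (rsubmx Q)^T)) = - (gam *: (c' *m (lsubmx Q)^T)).
  move: (c' *m (lsubmx Q)^T) (z' *m (rsubmx Q)^T) => a b.
  by apply/matrixP => i j; rewrite !mxE; ring.
by rewrite mulNmx mulmxBr -scalemxAl -scalemxAr mulmxA.
Qed.

(** * Application to the saddle-point problem *)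

Lemma pd_step_contraction (R : realType) p n m (gam alpha beta : R)
    (g : 'rV[R]_p -> 'rV[R]_n -> \bar R) (fs : 'rV[R]_p -> 'rV[R]_m -> \bar R)
    (K : 'rV[R]_p -> 'M[R]_(m, n)) th (a b : 'rV[R]_(n + m)) :
  0 < gam -> 0 < alpha -> 0 <= beta -> opnorm (K th) <= beta ->
  closed_fun (g th) -> proper_fun (g th) -> strongly_convex alpha (g th) ->
  closed_fun (fs th) -> proper_fun (fs th) -> strongly_convex alpha (fs th) ->
  enorm (pd_step gam g fs K th a - pd_step gam g fs K th b) <=
    (1 + gam * alpha)^-1 * Num.sqrt (1 + (gam * beta) ^+ 2) * enorm (a - b).
Proof.
move=> g0 a0 b0 Kb cg pg sg cf pf sf; rewrite /pd_step.
apply: le_trans (Tmap_lipschitz _ _ g0 a0 cg pg sg cf pf sf) _.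
rewrite -mulrA ler_wpM2l ?invr_ge0 ?addr_ge0 ?mulr_ge0 ?(ltW g0) ?(ltW a0)//.
have -> : a - gam *: Bmap K (row_mx th a) - (b - gam *: Bmap K (row_mx th b)) =
    (a - b) - gam *: (Bmap K (row_mx th a) - Bmap K (row_mx th b)).
  by apply/matrixP => i j; rewrite !mxE; ring.
by rewrite Bmap_sub; exact: Bmap_step_le.
Qed.

Lemma Tmap_clarke_block (R : realType) p n m (Theta : set 'rV[R]_p) (gam alpha : R)
    (g : 'rV[R]_p -> 'rV[R]_n -> \bar R) (fs : 'rV[R]_p -> 'rV[R]_m -> \bar R)
    th w U V (h : 'rV[R]_(n + m)) :
  open Theta -> 0 < gam -> 0 < alpha ->
  (forall th, Theta th ->
     closed_fun (g th) /\ proper_fun (g th) /\ strongly_convex alpha (g th) /\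
     closed_fun (fs th) /\ proper_fun (fs th) /\ strongly_convex alpha (fs th)) ->
  Theta th -> clarke (Tmap gam g fs) (row_mx th w) (row_mx U V) ->
  enorm (h *m V^T) <= (1 + gam * alpha)^-1 * enorm h.
Proof.
move=> oT g0 a0 H Tth cUV.
have rho0 : 0 <= (1 + gam * alpha)^-1.
  by rewrite invr_ge0 addr_ge0// mulr_ge0 ?(ltW g0) ?(ltW a0).
apply: enorm_le_dual => [|y]; first by rewrite mulr_ge0 ?enorm_ge0.
apply: (clarke_block_le oT Tth) cUV => th' w' t Tth' t0.
have [cg [pg [sg [cf [pf sf]]]]] := H th' Tth'.
apply: le_trans (dotv_le_enorm _ _) _; rewrite mulrA ler_wpM2r ?enorm_ge0//.
apply: le_trans (Tmap_lipschitz _ _ g0 a0 cg pg sg cf pf sf) _.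
by rewrite addrK enormZ gtr0_norm// mulrCA.
Qed.

Lemma Bmap_clarke_block (R : realType) p n m (Theta : set 'rV[R]_p) (gam beta : R)
    (K : 'rV[R]_p -> 'M[R]_(m, n)) th z W Z (h : 'rV[R]_(n + m)) :
  open Theta -> 0 <= beta -> (forall th, Theta th -> opnorm (K th) <= beta) ->
  Theta th -> clarke (Bmap K) (row_mx th z) (row_mx W Z) ->
  enorm (h - gam *: (h *m Z^T)) <= Num.sqrt (1 + (gam * beta) ^+ 2) * enorm h.
Proof.
move=> oT b0 Kb Tth cWZ; set sigma := Num.sqrt _.
apply: enorm_le_dual => [|y]; first by rewrite mulr_ge0 ?enorm_ge0// sqrtr_ge0.
(* Clarke estimates bound linear functionals of [h *m Z^T] only, so the constant part [dotv h y]
   moves to the right and [- gam] into the test vector. *)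
suff : dotv (h *m Z^T) (- gam *: y) <= sigma * enorm h * enorm y - dotv h y.
  by rewrite dotvDl dotvNl dotvZl dotvZr; lra.
apply: (clarke_block_le oT Tth) cWZ => th' w' t Tth' t0.
rewrite Bmap_sub addrK BmapZ dotvZl dotvZr ler_pM2l//.
have := le_trans (dotv_le_enorm _ y)
  (ler_wpM2r (enorm_ge0 y) (Bmap_step_le gam h (Kb th' Tth') b0)).
by rewrite dotvDl dotvNl dotvZl -/sigma; lra.
Qed.

Theorem theorem8 (R : realType) (p n m : nat) (Theta : set 'rV[R]_p)
  (alpha beta gam : R)
  (g : 'rV[R]_p -> 'rV[R]_n -> \bar R) (fs : 'rV[R]_p -> 'rV[R]_m -> \bar R)
  (K : 'rV[R]_p -> 'M[R]_(m, n)) :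
  open Theta -> connected Theta -> Theta !=set0 ->
  0 < alpha -> 0 < beta ->
  (forall th, Theta th ->
     closed_fun (g th) /\ proper_fun (g th) /\ strongly_convex alpha (g th) /\
     closed_fun (fs th) /\ proper_fun (fs th) /\ strongly_convex alpha (fs th) /\
     0 < opnorm (K th) /\ opnorm (K th) <= beta) ->
  0 < gam -> gam < 2 * alpha / (alpha + beta) ^+ 2 ->
  path_diff_on [set w : 'rV[R]_(p + (n + m)) | Theta (lsubmx w)] (Tmap gam g fs) ->
  path_diff_on [set w : 'rV[R]_(p + (n + m)) | Theta (lsubmx w)] (Bmap K) ->
  exists zs : 'rV[R]_p -> 'rV[R]_(n + m),
    (* unique saddle point *)
    (forall th, Theta th -> forall x y,
        is_saddle (g th) (fs th) (K th) x y <-> row_mx x y = zs th) /\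
    (* characterization by the optimality inclusions *)
    (forall th, Theta th -> forall x y,
        is_saddle (g th) (fs th) (K th) x y <->
        (subdiff (fs th) y (x *m (K th)^T) /\ subdiff (g th) x (- (y *m K th)))) /\
    (* the matrices in the formula are invertible *)
    (forall th, Theta th -> forall U V W Z,
        clarke (Tmap gam g fs)
          (row_mx th (row_mx (lsubmx (zs th) - gam *: (rsubmx (zs th) *m K th))
                             (rsubmx (zs th) + gam *: (lsubmx (zs th) *m (K th)^T))))
          (row_mx U V) ->
        clarke (Bmap K) (row_mx th (zs th)) (row_mx W Z) ->
        (1%:M - V *m (1%:M - gam *: Z)) \in unitmx) /\
    (* path differentiability with the given conservative Jacobian *)
    loc_lipschitz_on Theta zs /\
    conservative_on Theta zs (fun th => [set M | exists U V W Z,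
        clarke (Tmap gam g fs)
          (row_mx th (row_mx (lsubmx (zs th) - gam *: (rsubmx (zs th) *m K th))
                             (rsubmx (zs th) + gam *: (lsubmx (zs th) *m (K th)^T))))
          (row_mx U V) /\
        clarke (Bmap K) (row_mx th (zs th)) (row_mx W Z) /\
        M = invmx (1%:M - V *m (1%:M - gam *: Z)) *m (U - gam *: (V *m W))]).
Proof.
move=> oT _ _ a0 b0 H g0 gab pT pB.
pose rho := (1 + gam * alpha)^-1; pose sigma := Num.sqrt (1 + (gam * beta) ^+ 2).
have rs1 : rho * sigma < 1 by exact: contraction_rate.
have rho0 : 0 <= rho by rewrite invr_ge0 addr_ge0// mulr_ge0 ?(ltW g0) ?(ltW a0).
have rs0 : 0 <= rho * sigma by rewrite mulr_ge0// sqrtr_ge0.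
have Kb th : Theta th -> opnorm (K th) <= beta by move=> /H[_ [_ [_ [_ [_ [_ [_ ]]]]]]].
have H' th : Theta th ->
     closed_fun (g th) /\ proper_fun (g th) /\ strongly_convex alpha (g th) /\
     closed_fun (fs th) /\ proper_fun (fs th) /\ strongly_convex alpha (fs th).
  by move=> /H[? [? [? [? [? [? _]]]]]].
pose G := pd_step gam g fs K.
have Gq th : Theta th -> forall a b,
    enorm (G th a - G th b) <= rho * sigma * enorm (a - b).
  move=> Tth a b; have [cg [pg [sg [cf [pf sf]]]]] := H' th Tth.
  by apply: pd_step_contraction => //; [exact: ltW|exact: Kb].
(* On [Theta] the set is a singleton by the contraction property; elsewhere the value is
   arbitrary. *)
pose zs th := xget 0 [set z | G th z = z].
have zsE th : Theta th -> G th (zs th) = zs th.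
  move=> Tth; have [z Gz] := enorm_contraction_fixed rs0 rs1 (Gq th Tth).
  exact: (@xgetPex _ 0 [set z | G th z = z] (ex_intro _ z Gz)).
have zs_uniq th z : Theta th -> G th z = z -> z = zs th.
  move=> Tth Gz; have := Gq th Tth z (zs th); rewrite Gz zsE// => Hle.
  apply/eqP; rewrite -subr_eq0; apply/eqP/enorm0_eq0/eqP.
  rewrite eq_le enorm_ge0 andbT leNgt; apply/negP => z0.
  by move: Hle; rewrite leNgt gtr_pMl// rs1.
pose wT th := row_mx th (zs th - gam *: Bmap K (row_mx th (zs th))) : 'rV[R]_(p + (n + m)).
(* The explicit evaluation point of the formula is the forward step [zs - gam B(th, zs)]; the sign
   of the second block comes from the minus sign in [B]. *)
have wTE th : row_mx th (row_mx (lsubmx (zs th) - gam *: (rsubmx (zs th) *m K th))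
      (rsubmx (zs th) + gam *: (lsubmx (zs th) *m (K th)^T))) = wT th.
  rewrite /wT /Bmap !row_mxKl !row_mxKr -[in RHS](hsubmxK (zs th)) !row_mxKl !row_mxKr.
  by rewrite scale_row_mx opp_row_mx add_row_mx scalerN opprK.
have lzs : loc_lipschitz_on Theta zs.
  apply: (fixed_point_loc_lipschitz oT rs1 Gq _ zsE).
  pose D := [set w : 'rV[R]_(p + (n + m)) | Theta (lsubmx w)].
  apply: (loc_lipschitz_comp (E := D) (G := Tmap gam g fs)
    (F := fun w => row_mx (lsubmx w) (rsubmx w - gam *: Bmap K (row_mx (lsubmx w) (rsubmx w))))) pT.1 _.
    apply: loc_lipschitz_row_mx.
      by apply: loc_lipschitz_lip1 => a b; rewrite -linearB mx_norm_lsubmx.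
    apply: loc_lipschitz_subZ.
      by apply: loc_lipschitz_lip1 => a b; rewrite -linearB mx_norm_rsubmx.
    rewrite (_ : (fun w => _) = Bmap K); first exact: pB.1.
    by apply/funext => w; rewrite hsubmxK.
  by move=> w Tw; rewrite /D/= row_mxKl.
exists zs; split.
  move=> th Tth x y; have [cg [pg [sg [cf [pf sf]]]]] := H' th Tth.
  have fixP := pd_step_fixed K x y g0 a0 cg pg sg cf pf sf.
  split; first by move=> /fixP; exact: zs_uniq.
  by move=> xy; apply/fixP; rewrite xy; exact: zsE.
split.
  move=> th Tth x y; have [_ [pg [_ [_ [pf _]]]]] := H' th Tth.
  exact: saddle_subdiff.
have hV th U V : Theta th -> clarke (Tmap gam g fs) (wT th) (row_mx U V) ->
    forall h : 'rV[R]_(n + m), enorm (h *m V^T) <= rho * enorm h.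
  by move=> Tth cUV h; exact: (Tmap_clarke_block h oT g0 a0 H' Tth cUV).
have hZ th W Z : Theta th -> clarke (Bmap K) (row_mx th (zs th)) (row_mx W Z) ->
    forall h : 'rV[R]_(n + m), enorm (h - gam *: (h *m Z^T)) <= sigma * enorm h.
  by move=> Tth cWZ h; exact: (Bmap_clarke_block gam h oT (ltW b0) Kb Tth cWZ).
split.
  move=> th Tth U V W Z; rewrite wTE => cUV cWZ.
  by have [] := fixed_point_unit rs1 rho0 (hV th U V Tth cUV) (hZ th W Z Tth cWZ).
split => //.
apply: (implicit_conservative (T := Tmap gam g fs) (B := Bmap K) (rho := rho) (sigma := sigma)
  (wT := fun th => row_mx th (row_mx (lsubmx (zs th) - gam *: (rsubmx (zs th) *m K th))
      (rsubmx (zs th) + gam *: (lsubmx (zs th) *m (K th)^T))))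
  (wB := fun th => row_mx th (zs th)) oT pT pB) => //.
- by move=> th Tth; rewrite wTE; exact: zsE.
- by move=> th Tth U V; rewrite wTE; exact: hV.
- by move=> th Tth W Z; exact: hZ.
Qed.
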